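(* For a finite-dimensional tele-covariant tripartite channel $\mathcal{N}_{A'B'C'\to ABC}$, $$I[A;C|B]_{\mathcal{N}}=I(R_AA;C|R_BBR_C)_{\Phi^{\mathcal{N}}},$$ where $\Phi^{\mathcal{N}}_{R_AAR_BBR_CC}=\mathcal{N}(\Phi_{R_AA'}\otimes\Phi_{R_BB'}\otimes\Phi_{R_CC'})$.
   Context: $\Phi_{RX}$ is the normalized maximally entangled state, $R_X\simeq X'$. $D$ is the Umegaki relative entropy; $D[\mathcal{K}\Vert\mathcal{L}]:=\sup_{\rho_{RX'}}D((\mathrm{id}_R\otimes\mathcal{K})(\rho)\Vert(\mathrm{id}_R\otimes\mathcal{L})(\rho))$; $\mathcal{R}_{A'\to A}(Y)=\operatorname{tr}(Y)\mathbbm{1}_A$. Define $S[A|BC]_{\mathcal{N}}:=-\inf_{\mathcal{M}\in\mathrm{Q}(B'C',BC)}D[\mathcal{N}\Vert\mathcal{R}_{A'\to A}\otimes\mathcal{M}_{B'C'\to BC}]$ and $S[A|B]_{\mathcal{N}}:=-\inf_{\mathcal{P}\in\mathrm{Q}(B'C',B)}D[\operatorname{tr}_C\circ\mathcal{N}\Vert\mathcal{R}_{A'\to A}\otimes\mathcal{P}_{B'C'\to B}]$, and the conditional mutual information of the channel $I[A;C|B]_{\mathcal{N}}:=S[A|B]_{\mathcal{N}}-S[A|BC]_{\mathcal{N}}$. For states, $I(X;Z|Y)=S(X|Y)-S(X|YZ)$. A tripartite channel is tele-covariant if there are finite groups with unitary one-design representations $U^{g}_{A'},U^h_{B'},U^l_{C'}$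 (e.g. $\frac{1}{|G|}\sum_gU^gXU^{g\dagger}=\operatorname{tr}(X)\mathbbm{1}/|A'|$) and unitary representations $V^g_A,W^h_B,Y^l_C$ such that $\mathcal{N}((U^g\otimes U^h\otimes U^l)\rho(\cdot)^\dagger)=(V^g\otimes W^h\otimes Y^l)\mathcal{N}(\rho)(\cdot)^\dagger$ for all $\rho,g,h,l$. *)

(* Defs.v *)
From HB Require Import structures.
From mathcomp Require Import all_boot all_order all_algebra.
From mathcomp Require Import all_fingroup complex.
From mathcomp Require Import boolp classical_sets reals ereal exp.
Set Implicit Arguments.
Unset Strict Implicit.
Unset Printing Implicit Defensive.
Import Order.TTheory GRing.Theory Num.Theory.
Local Open Scope ring_scope.

Section QuantumDefs.
Variable R : realType.
Local Notation C := (R[i]).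

(** Operators on a finite-dimensional system whose orthonormal basis is
    labelled by the finite type T (so the Hilbert space is C^#|T|). *)
Definition op (T : finType) := 'M[C]_#|T|.
Arguments op T%_type.

Definition ent (T : finType) (X : op T) (x y : T) : C :=
  X (enum_rank x) (enum_rank y).

Definition mkop (T : finType) (f : T -> T -> C) : op T :=
  \matrix_(i, j) f (enum_val i) (enum_val j).

Definition adj m n (X : 'M[C]_(m, n)) : 'M[C]_(n, m) := map_mx Num.conj (X^T).

Definition psd (T : finType) (X : op T) : Prop :=
  forall v : 'cV[C]_#|T|, 0 <= (adj v *m X *m v) 0 0.

Definition density (T : finType) (X : op T) : Prop := psd X /\ \tr X = 1.

Definition unitary (T : finType) (U : op T) : Prop := U *m adj U = 1%:M.

Definition tens (S T : finType) (X : op S) (Y : op T) : op (S * T) :=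
  mkop (fun x y => ent X x.1 y.1 * ent Y x.2 y.2).

Definition ptr2 (S T : finType) (X : op (S * T)) : op S :=
  mkop (fun s s' => \sum_(t : T) ent X (s, t) (s', t)).

Definition ptr1 (S T : finType) (X : op (S * T)) : op T :=
  mkop (fun t t' => \sum_(s : S) ent X (s, t) (s, t')).

(** relabel e X has entries <x|.|y> = <e x|X|e y>; used with bijections e
    to reorder tensor factors *)
Definition relabel (S T : finType) (e : T -> S) (X : op S) : op T :=
  mkop (fun x y => ent X (e x) (e y)).

Definition eunit (T : finType) (x y : T) : op T :=
  mkop (fun a b => ((a == x) && (b == y))%:R).

(** id_Ref (x) K *)
Definition idt (Rf S T : finType) (K : op S -> op T) (X : op (Rf * S))
  : op (Rf * T) :=
  mkop (fun u v => ent (K (mkop (fun s s' => ent X (u.1, s) (v.1, s')))) u.2 v.2).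

Definition tensmap (S1 S2 T1 T2 : finType) (K1 : op S1 -> op T1)
  (K2 : op S2 -> op T2) (X : op (S1 * S2)) : op (T1 * T2) :=
  \sum_(x : (S1 * S2)%type) \sum_(y : (S1 * S2)%type)
     ent X x y *: tens (K1 (eunit x.1 y.1)) (K2 (eunit x.2 y.2)).

Definition is_linear_map (S T : finType) (K : op S -> op T) : Prop :=
  forall (a : C) (X Y : op S), K (a *: X + Y) = a *: K X + K Y.

Definition completely_positive (S T : finType) (K : op S -> op T) : Prop :=
  forall (n : nat) (X : op ('I_n * S)), psd X -> psd (idt K X).

Definition trace_preserving (S T : finType) (K : op S -> op T) : Prop :=
  forall X : op S, \tr (K X) = \tr X.

Definition channel (S T : finType) (K : op S -> op T) : Prop :=
  [/\ is_linear_map K, completely_positive K & trace_preserving K].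

Definition replacer (S T : finType) (Y : op S) : op T := \tr Y *: 1%:M.

(** functional calculus for normal (here: Hermitian) matrices via the
    spectral decomposition X = P^-1 diag(d) P of mathcomp's spectral.v;
    f is applied to the real parts of the eigenvalues *)
Definition fmx (T : finType) (f : R -> R) (X : op T) : op T :=
  invmx (spectralmx X) *m
  diag_mx (map_mx (fun z : C => (f (complex.Re z))%:C%C) (spectral_diag X))
  *m spectralmx X.

(** matrix logarithm (on the support; ln 0 = 0 in mathcomp-analysis) *)
Definition logm (T : finType) (X : op T) : op T := fmx (@ln R) X.

(** supp X included in supp Y, i.e. ker Y included in ker X *)
Definition supp_le (T : finType) (X Y : op T) : Prop :=
  forall v : 'cV[C]_#|T|, Y *m v = 0 -> X *m v = 0.

Definition relent (T : finType) (rho sigma : op T) : \bar R :=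
  if `[< supp_le rho sigma >]
  then (complex.Re (\tr (rho *m (logm rho - logm sigma))))%:E
  else +oo%E.

Definition vNent (T : finType) (rho : op T) : R :=
  - complex.Re (\tr (rho *m logm rho)).

Definition condent (X Y : finType) (rho : op (X * Y)) : R :=
  vNent rho - vNent (ptr1 rho).

Definition cmi (X Y Z : finType) (rho : op ((X * Y) * Z)) : R :=
  condent (ptr2 rho)
  - condent (relabel (fun u : (X * (Y * Z))%type => ((u.1, u.2.1), u.2.2)) rho).

(** channel divergence D[K || L], reference R_X ~ X' *)
Definition chdiv (S T : finType) (K L : op S -> op T) : \bar R :=
  ereal_sup [set relent (idt K rho) (idt L rho) |
             rho in [set rho : op (S * S) | density rho]].

Definition chcondent_ABC (A' B' C' A B C : finType)
  (N : op (A' * (B' * C')) -> op (A * (B * C))) : \bar R :=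
  (- ereal_inf [set chdiv N (tensmap (@replacer A' A) M) |
                M in [set M : op (B' * C') -> op (B * C) | channel M]])%E.

Definition trC (A B C : finType) (X : op (A * (B * C))) : op (A * B) :=
  ptr2 (relabel (fun u : ((A * B) * C)%type => (u.1.1, (u.1.2, u.2))) X).

Definition chcondent_AB (A' B' C' A B C : finType)
  (N : op (A' * (B' * C')) -> op (A * (B * C))) : \bar R :=
  (- ereal_inf [set chdiv (fun X => trC (N X)) (tensmap (@replacer A' A) P) |
                P in [set P : op (B' * C') -> op B | channel P]])%E.

Definition chcmi (A' B' C' A B C : finType)
  (N : op (A' * (B' * C')) -> op (A * (B * C))) : \bar R :=
  (chcondent_AB N - chcondent_ABC N)%E.

Definition maxent (T : finType) : op (T * T) :=
  mkop (fun x y => ((x.1 == x.2) && (y.1 == y.2))%:R / #|T|%:R).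

(** Phi^N on (R_A (R_B R_C)) (A (B C)); since the tensor product of the
    three maximally entangled states is (up to reordering of factors) the
    maximally entangled state of A'B'C' with its reference R_A R_B R_C *)
Definition choi_state (A' B' C' A B C : finType)
  (N : op (A' * (B' * C')) -> op (A * (B * C))) :
  op ((A' * (B' * C')) * (A * (B * C))) :=
  idt N (maxent (A' * (B' * C'))%type).

Definition unitary_rep (gT : finGroupType) (T : finType) (U : gT -> op T) : Prop :=
  [/\ U 1%g = 1%:M, (forall g h : gT, U (g * h)%g = U g *m U h)
    & forall g, unitary (U g)].

Definition one_design (gT : finGroupType) (T : finType) (U : gT -> op T) : Prop :=
  forall X : op T,
    (#|gT|%:R)^-1 *: \sum_(g : gT) (U g *m X *m adj (U g))
    = (\tr X / #|T|%:R) *: 1%:M.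

Definition uconj (T : finType) (U X : op T) : op T := U *m X *m adj U.

Definition tele_covariant (A' B' C' A B C : finType)
  (N : op (A' * (B' * C')) -> op (A * (B * C))) : Prop :=
  exists (gG gH gL : finGroupType)
         (UA : gG -> op A') (UB : gH -> op B') (UC : gL -> op C')
         (V : gG -> op A) (W : gH -> op B) (Y : gL -> op C),
    [/\ [/\ unitary_rep UA, unitary_rep UB & unitary_rep UC],
        [/\ one_design UA, one_design UB & one_design UC],
        [/\ unitary_rep V, unitary_rep W & unitary_rep Y] &
        forall (rho : op (A' * (B' * C'))) g h l, density rho ->
          N (uconj (tens (UA g) (tens (UB h) (UC l))) rho)
          = uconj (tens (V g) (tens (W h) (Y l))) (N rho)].

End QuantumDefs.

(* Main.v *)
Require Import Defs.
From HB Require Import structures.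
From mathcomp Require Import all_boot all_order all_algebra all_fingroup complex.
From mathcomp Require Import boolp classical_sets reals ereal exp.
From mathcomp Require Import functions topology normedtype derive realfun.
From mathcomp Require Import sesquilinear spectral ring lra.

(** A covariant channel satisfies [N (rho) = T (Phi^N)], where the Kraus map [T] teleports
    [rho] through the Choi state and depends only on [rho] and the symmetry. Covariance also
    makes [tr_A N] a function of the [B'C'] marginal of the input, so the reference
    [R (x) M] with [M (Y) = tr_A N (1/|A'| (x) Y)] is [X |-> 1_A (x) tr_A N (X)], which has the
    same symmetry and is teleported by the same [T]. Monotonicity of the relative entropy
    under [T] then shows that the maximally entangled input attains [D[N || R (x) M]], and
    Klein's inequality shows that this [M] attains the infimum, with value
    [ln |A'| - S (R_A A | R_B R_C B C)]. The same argument for [tr_C o N] gives the other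
    conditional entropy and the two terms [ln |A'|] cancel.

    Monotonicity: for eigenvalues [p_i] of [X], [q_j] of [S] and overlaps [c_ij], the function
    [\sum c_ij p_i ln ((1 - u) q_j + u p_i)] of [u] runs from [tr (X ln S)] to [tr (X ln X)],
    and its derivative is [(f_u - tr X) / (1 - u)] with [f_u] the maximum over [Y] of
    [Re (2 tr (X Y) - (1 - u) tr (S Y Y^dag) - u tr (X Y^dag Y))]. The Schwarz inequality for
    the dual of a Kraus map shows that [f_u] decreases, and the mean value theorem concludes. *)

Set Implicit Arguments.
Unset Strict Implicit.
Unset Printing Implicit Defensive.
Import Order.TTheory GRing.Theory Num.Theory.
Import numFieldNormedType.Exports.
Local Open Scope ring_scope.

(** * Matrices and functional calculus *)

(** Scalar part of the polarization argument in [psdmx_hermitian]: [a] and [b] are the two cross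
    terms of a sesquilinear form whose diagonal values are real. The hypotheses reduce to
    [a^* + b^* = a + b] and [b^* - a^* = a - b]. *)
Lemma conj_of_polarization (F : numClosedFieldType) (a b p q q' : F) :
  p^* = p -> q^* = q -> q'^* = q' -> (p + a + b + q)^* = p + a + b + q ->
  (p + 'i * a - 'i * b + q')^* = p + 'i * a - 'i * b + q' -> a^* = b.
Proof.
move=> hp hq hq'; rewrite !(rmorphD, rmorphN, rmorphM) /= hp hq hq' !conjCi.
move: (a^*) (b^*) => a' b' e1 e2.
have e3 : a' + b' = a + b.
  by apply: (addrI p); apply: (addIr q); rewrite !addrA.
have e4 : 'i * (b' - a') = 'i * (a - b).
  by apply: (addrI p); apply: (addIr q'); rewrite !mulrBr !addrA -e2; ring.
move/(mulfI (neq0Ci _)): e4 => e4.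
have : 2 * a' = 2 * b.
  by rewrite (_ : 2 * a' = (a' + b') - (b' - a')); [rewrite e3 e4|]; ring.
by move/mulfI; apply; rewrite pnatr_eq0.
Qed.

Section MatrixAnalysis.
Variable R : realType.
Local Notation C := (R[i]).
Local Notation Re := (@complex.Re R).

Lemma conj_real_complex (x : R) : (x%:C%C : C)^* = x%:C%C.
Proof. by apply: conj_Creal; apply/complex_realP; exists x. Qed.

Lemma adjmxE m n (A : 'M[C]_(m, n)) i j : adj A i j = (A j i)^*.
Proof. by rewrite !mxE. Qed.

Lemma adjmxK m n (A : 'M[C]_(m, n)) : adj (adj A) = A.
Proof. by apply/matrixP=> i j; rewrite !mxE conjCK. Qed.

Lemma adjmxM m n p (A : 'M[C]_(m, n)) (B : 'M[C]_(n, p)) :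
  adj (A *m B) = adj B *m adj A.
Proof. by rewrite /adj trmx_mul map_mxM. Qed.

Lemma adjmxD m n (A B : 'M[C]_(m, n)) : adj (A + B) = adj A + adj B.
Proof. by rewrite /adj linearD /= map_mxD. Qed.

Lemma adjmxB m n (A B : 'M[C]_(m, n)) : adj (A - B) = adj A - adj B.
Proof. by rewrite /adj linearB /= map_mxB. Qed.

Lemma adjmxZ m n (c : C) (A : 'M[C]_(m, n)) : adj (c *: A) = c^* *: adj A.
Proof. by rewrite /adj linearZ /= map_mxZ. Qed.

Lemma adjmx1 n : adj (1%:M : 'M[C]_n) = 1%:M.
Proof. by rewrite /adj trmx1 map_mx1. Qed.

Lemma adjmx_sum m n (I : finType) (F : I -> 'M[C]_(m, n)) :
  adj (\sum_i F i) = \sum_i adj (F i).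
Proof. by rewrite /adj linear_sum /= (big_morph _ (@map_mxD _ _ _ _ _) (@map_mx0 _ _ _ _ _)). Qed.

Lemma mul_adj_ge0 n (v : 'cV[C]_n) : 0 <= (adj v *m v) 0 0.
Proof.
by rewrite mxE sumr_ge0// => i _; rewrite adjmxE mulrC mul_conjC_ge0.
Qed.

Lemma mul_adj_eq0 n (v : 'cV[C]_n) : (adj v *m v) 0 0 = 0 -> v = 0.
Proof.
move=> v0; apply/matrixP=> i j; rewrite (ord1 j) [RHS]mxE; move: v0; rewrite mxE => /eqP.
rewrite psumr_eq0; last by move=> k _; rewrite adjmxE mulrC mul_conjC_ge0.
by move=> /allP/(_ i (mem_index_enum _)); rewrite adjmxE mulrC mul_conjC_eq0 => /eqP.
Qed.

(** The condition [psd] for matrices of any size; the two agree by conversion on [op]. The same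
    holds for [fcalc] and [fmx] below. *)
Definition psdmx n (X : 'M[C]_n) := forall v : 'cV[C]_n, 0 <= (adj v *m X *m v) 0 0.

Definition dgmx n (f : 'I_n -> R) : 'M[C]_n := diag_mx (\row_i (f i)%:C%C).

Definition eigv n (X : 'M[C]_n) i : R := Re (spectral_diag X 0 i).

Definition fcalc n (f : R -> R) (X : 'M[C]_n) : 'M[C]_n :=
  invmx (spectralmx X) *m
  diag_mx (map_mx (fun z : C => (f (complex.Re z))%:C%C) (spectral_diag X))
  *m spectralmx X.

Lemma logmE (T : finType) (X : op R T) : logm X = fcalc (@ln R) X.
Proof. by []. Qed.

Lemma mul_spectral_adj n (X : 'M[C]_n) : spectralmx X *m adj (spectralmx X) = 1%:M.
Proof. by have /unitarymxP := spectral_unitarymx X. Qed.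

Lemma mul_adj_spectral n (X : 'M[C]_n) : adj (spectralmx X) *m spectralmx X = 1%:M.
Proof. exact/mulmx1C/mul_spectral_adj. Qed.

Lemma invmx_spectral n (X : 'M[C]_n) : invmx (spectralmx X) = adj (spectralmx X).
Proof.
by rewrite -[LHS]mulmx1 -(mul_spectral_adj X) mulmxA mulVmx ?mul1mx // spectral_unit.
Qed.

Lemma fcalcE n f (X : 'M[C]_n) :
  fcalc f X = adj (spectralmx X) *m dgmx (fun i => f (eigv X i)) *m spectralmx X.
Proof.
rewrite /fcalc invmx_spectral; congr (_ *m diag_mx _ *m _).
by apply/rowP=> i; rewrite !mxE.
Qed.

Lemma hermitian_spectral n (X : 'M[C]_n) : adj X = X ->
  X = adj (spectralmx X) *m dgmx (eigv X) *m spectralmx X.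
Proof.
move=> hX; have hh : X \is hermsymmx.
  by apply/is_hermitianmxP; rewrite expr0 scale1r -[LHS]hX.
have := hermitian_spectral_diag_real hh => /mxOverP hr.
rewrite {1}(orthomx_spectralP (hermitian_normalmx hh)) invmx_spectral.
congr (_ *m diag_mx _ *m _).
apply/rowP=> i; rewrite !mxE /eigv; have := hr 0 i.
by case: (spectral_diag X 0 i) => a b; rewrite complex_real /= => /eqP ->.
Qed.

(** In the order on complex numbers, [0 <= z] includes that [z] is real. So the form is real on the
    diagonal, and the vectors [v + w] and [v + 'i *: w] give its Hermitian symmetry. *)
Lemma psdmx_hermitian n (X : 'M[C]_n) : psdmx X -> adj X = X.
Proof.
move=> hX; pose s (v w : 'cV[C]_n) := (adj v *m X *m w) 0 0.
have sD v w v' w' : s (v + v') (w + w') = s v w + s v w' + s v' w + s v' w'.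
  by rewrite /s adjmxD !mulmxDl !mulmxDr [LHS]mxE [X in X + _ = _]mxE [X in _ + X = _]mxE !addrA (addrAC (s v w)).
have sZ c d v w : s (c *: v) (d *: w) = c^* * d * s v w.
  by rewrite /s adjmxZ -!scalemxAl -scalemxAr scalerA mxE.
have sreal v : (s v v)^* = s v v by apply/CrealP; rewrite ger0_real //; exact: hX.
have sC v w : (s v w)^* = s w v.
  have h1 := sreal (v + w); have h2 := sreal (v + 'i *: w).
  apply: (conj_of_polarization (sreal v) (sreal w) (sreal ('i *: w))).
    by move: h1; rewrite sD.
  move: h2; rewrite sD.
  have -> : s v ('i *: w) = 'i * s v w by rewrite -{1}[v]scale1r sZ conjC1 mul1r.
  have -> : s ('i *: w) v = - 'i * s w v by rewrite -{1}[v]scale1r sZ conjCi mulr1.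
  by rewrite mulNr.
apply/matrixP=> i j; rewrite adjmxE.
have sE k l : s (delta_mx k 0) (delta_mx l 0) = X k l.
  rewrite /s.
  have -> : adj (delta_mx k 0 : 'cV[C]_n) = delta_mx 0 k.
    by apply/matrixP=> a b; rewrite !mxE rmorph_nat andbC.
  by rewrite -rowE -colE !mxE.
by rewrite -!sE sC.
Qed.

Lemma psdmx_eigv n (X : 'M[C]_n) i : psdmx X -> 0 <= eigv X i.
Proof.
move=> hX; pose v := col i (adj (spectralmx X)).
have := hX v; rewrite {1}(hermitian_spectral (psdmx_hermitian hX)).
have -> : v = adj (spectralmx X) *m delta_mx i 0 by rewrite -colE.
rewrite adjmxM adjmxK !mulmxA -(mulmxA _ (spectralmx X)) mul_spectral_adj mulmx1.
rewrite -(mulmxA _ (spectralmx X)) mul_spectral_adj mulmx1.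
have -> : adj (delta_mx i 0 : 'cV[C]_n) = delta_mx 0 i.
  by apply/matrixP=> a b; rewrite !mxE rmorph_nat andbC.
by rewrite -rowE -colE !mxE eqxx mulr1n lecE /= => /andP[].
Qed.

Lemma psdmx_factor n (X : 'M[C]_n) : psdmx X -> exists B : 'M[C]_n, X = B *m adj B.
Proof.
move=> hX; exists (adj (spectralmx X) *m dgmx (fun i => Num.sqrt (eigv X i))).
rewrite adjmxM adjmxK !mulmxA {1}(hermitian_spectral (psdmx_hermitian hX)).
congr (_ *m _); rewrite -mulmxA; congr (_ *m _).
have -> : adj (dgmx (fun i => Num.sqrt (eigv X i))) = dgmx (fun i => Num.sqrt (eigv X i)).
  apply/matrixP=> a b; rewrite !mxE; case: eqVneq => [->|ab].
    by rewrite !mulr1n conj_real_complex.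
  by rewrite !mulr0n rmorph0.
rewrite mulmx_diag; congr diag_mx; apply/rowP=> i; rewrite !mxE -rmorphM /=.
by rewrite -expr2 sqr_sqrtr // psdmx_eigv.
Qed.

Lemma psdmx_ker n (X : 'M[C]_n) (v : 'cV[C]_n) : psdmx X -> (adj v *m X *m v) 0 0 = 0 -> X *m v = 0.
Proof.
move=> /psdmx_factor[B ->] h.
have /mul_adj_eq0 e : (adj (adj B *m v) *m (adj B *m v)) 0 0 = 0.
  by rewrite adjmxM adjmxK !mulmxA in h *.
by rewrite -mulmxA e mulmx0.
Qed.

Lemma psdmx_mul_adj m n (B : 'M[C]_(m, n)) : psdmx (B *m adj B).
Proof.
move=> v; have := mul_adj_ge0 (adj B *m v).
by rewrite adjmxM adjmxK !mulmxA.
Qed.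

Lemma psdmx_conj m n (W : 'M[C]_(m, n)) X : psdmx X -> psdmx (W *m X *m adj W).
Proof. by move=> /psdmx_factor[B ->]; rewrite mulmxA -mulmxA -adjmxM; exact: psdmx_mul_adj. Qed.

Lemma psdmx_sum n (I : finType) (F : I -> 'M[C]_n) :
  (forall i, psdmx (F i)) -> psdmx (\sum_i F i).
Proof.
move=> h v; rewrite mulmx_sumr mulmx_suml summxE sumr_ge0 // => i _; exact: h.
Qed.

Lemma psdmx_scale n (c : C) (X : 'M[C]_n) : 0 <= c -> psdmx X -> psdmx (c *: X).
Proof. by move=> c0 h v; rewrite -scalemxAr -scalemxAl mxE mulr_ge0. Qed.

Lemma mul_dgmx_entry n m (d : 'I_n -> R) (W : 'M[C]_(n, m)) i j :
  (dgmx d *m W) i j = (d i)%:C%C * W i j.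
Proof. by rewrite mul_diag_mx !mxE. Qed.

Lemma mul_mx_dgmx_entry n m (d : 'I_m -> R) (W : 'M[C]_(n, m)) i j :
  (W *m dgmx d) i j = W i j * (d j)%:C%C.
Proof. by rewrite mul_mx_diag !mxE. Qed.

(** In the eigenbasis of [X] the hypothesis says that a nonzero entry [(i, j)] of [P *m W] forces
    [eigv X i = e j], so [f] takes the same value on both. Hence the calculus does not depend on the
    chosen diagonalization. *)
Lemma fcalc_eigen n m f (X : 'M[C]_n) (W : 'M[C]_(n, m)) e :
  adj X = X -> X *m W = W *m dgmx e -> fcalc f X *m W = W *m dgmx (fun i => f (e i)).
Proof.
move=> hX; rewrite fcalcE {1}(hermitian_spectral hX); set P := spectralmx X.
move=> /(congr1 (mulmx P)); rewrite !mulmxA mul_spectral_adj mul1mx -mulmxA => h.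
have {}h : dgmx (fun i => f (eigv X i)) *m (P *m W) = P *m W *m dgmx (fun i => f (e i)).
  apply/matrixP=> i j; move/matrixP/(_ i j): h; rewrite !mul_dgmx_entry !mul_mx_dgmx_entry.
  have [->|nz] := eqVneq ((P *m W) i j) 0; first by rewrite !mulr0 !mul0r.
  rewrite mulrC => /(mulfI nz) [->]; exact: mulrC.
by rewrite -[in LHS]mulmxA -mulmxA h !mulmxA mul_adj_spectral mul1mx.
Qed.

(** The columns of [W *m adj Q], with [Q] the eigenbasis of [Y], are zero or eigenvectors of [X], so
    [fcalc_eigen] applies. The rectangular [W] covers relabelings and embeddings of tensor factors
    alike. *)
Lemma fcalc_intertwine n m f (X : 'M[C]_n) (Y : 'M[C]_m) (W : 'M[C]_(n, m)) :
  adj X = X -> adj Y = Y -> X *m W = W *m Y -> fcalc f X *m W = W *m fcalc f Y.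
Proof.
move=> hX hY h; pose Q := spectralmx Y.
have e : X *m (W *m adj Q) = W *m adj Q *m dgmx (eigv Y).
  rewrite mulmxA h {1}(hermitian_spectral hY) -!mulmxA mul_spectral_adj mulmx1.
  by rewrite !mulmxA.
have := fcalc_eigen f hX e => /(congr1 (mulmx^~ Q)).
by rewrite -!mulmxA mul_adj_spectral mulmx1 (fcalcE f Y) !mulmxA.
Qed.

Lemma fcalc_scale n f (c : R) (X : 'M[C]_n) : adj X = X ->
  fcalc f (c%:C%C *: X) = fcalc (fun x => f (c * x)) X.
Proof.
move=> hX; have hc : adj (c%:C%C *: X) = c%:C%C *: X.
  by rewrite adjmxZ hX; congr (_ *: _); rewrite conj_real_complex.
have e : (c%:C%C *: X) *m adj (spectralmx X)
       = adj (spectralmx X) *m dgmx (fun i => c * eigv X i).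
  rewrite {1}(hermitian_spectral hX) -scalemxAl -!mulmxA mul_spectral_adj mulmx1.
  rewrite scalemxAr; congr (_ *m _); apply/matrixP=> i j.
  by rewrite !mxE rmorphM /= mulrnAr.
have := fcalc_eigen f hc e => /(congr1 (mulmx^~ (spectralmx X))).
by rewrite -mulmxA mul_adj_spectral mulmx1 (fcalcE _ X) => ->.
Qed.

Lemma fcalc_id n (X : 'M[C]_n) : adj X = X -> fcalc id X = X.
Proof. by move=> hX; rewrite fcalcE -hermitian_spectral. Qed.

Lemma fcalc1 n (X : 'M[C]_n) : fcalc (fun=> 1) X = 1%:M.
Proof.
rewrite fcalcE (_ : dgmx _ = 1%:M) ?mulmx1 ?mul_adj_spectral //.
by apply/matrixP=> i j; rewrite !mxE.
Qed.

Lemma fcalcM n f g (X : 'M[C]_n) :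
  fcalc f X *m fcalc g X = fcalc (fun x => f x * g x) X.
Proof.
rewrite !fcalcE !mulmxA -(mulmxA _ (spectralmx X)) mul_spectral_adj mulmx1.
rewrite -(mulmxA (adj _) (dgmx _)) mulmx_diag; congr (_ *m diag_mx _ *m _).
by apply/rowP=> i; rewrite !mxE rmorphM.
Qed.

(** Squared modulus of the inner product of the [i]-th eigenvector of [X] and the [j]-th of [Y]. It
    turns traces of products of functions of [X] and [Y] into classical double sums over
    eigenvalues. *)
Definition overlap n (X Y : 'M[C]_n) i j : R :=
  Re (`|(spectralmx X *m adj (spectralmx Y)) i j| ^+ 2).

Lemma overlapE n (X Y : 'M[C]_n) i j :
  (overlap X Y i j)%:C%C = `|(spectralmx X *m adj (spectralmx Y)) i j| ^+ 2.
Proof. by rewrite /overlap RRe_real // ger0_real // exprn_ge0. Qed.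

Lemma overlap_ge0 n (X Y : 'M[C]_n) i j : 0 <= overlap X Y i j.
Proof. by rewrite -lecR overlapE exprn_ge0. Qed.

Lemma trace_fcalc2 n f g (X Y : 'M[C]_n) :
  \tr (fcalc f X *m fcalc g Y) =
  (\sum_i \sum_j overlap X Y i j * (f (eigv X i) * g (eigv Y j)))%:C%C.
Proof.
rewrite !fcalcE; set P := spectralmx X; set Q := spectralmx Y.
rewrite -!mulmxA mxtrace_mulC !mulmxA -!mulmxA.
have -> : dgmx (fun i => f (eigv X i)) *m (P *m (adj Q *m (dgmx (fun i => g (eigv Y i)) *m (Q *m adj P))))
  = dgmx (fun i => f (eigv X i)) *m ((P *m adj Q) *m dgmx (fun i => g (eigv Y i)) *m adj (P *m adj Q)).
  by rewrite adjmxM adjmxK !mulmxA.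
rewrite /mxtrace rmorph_sum; apply: eq_bigr=> i _.
rewrite mul_dgmx_entry mxE rmorph_sum mulr_sumr; apply: eq_bigr=> j _.
rewrite mul_mx_dgmx_entry adjmxE rmorphM /= rmorphM /= overlapE normCK; ring.
Qed.

End MatrixAnalysis.

(** * Monotonicity of the relative entropy *)

Section LogPath.
Variable R : realType.

Definition lnpath (I : finType) (c p q : I -> R) (u : R) : R :=
  \sum_i c i * ln ((1 - u) * q i + u * p i).

Lemma is_derive_lnpath (I : finType) (c p q : I -> R) (u : R) :
  (forall i, c i != 0 -> 0 < p i /\ 0 < q i) -> 0 <= u <= 1 ->
  is_derive u 1 (lnpath c p q)
    (\sum_i c i * ((p i - q i) / ((1 - u) * q i + u * p i))).
Proof.
move=> cpq /andP[u0 u1].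
have -> : lnpath c p q = \sum_i (fun u => c i * ln ((1 - u) * q i + u * p i)).
  by apply/funext=> v; rewrite /lnpath fct_sumE.
elim/big_ind2 : _ => [|f a g b|i _]; [exact: is_derive_cst|exact: is_deriveD|].
(* Nothing is known about [p i] and [q i] at zero weight, but the summand is then constantly
   zero. *)
have [->|c0] := eqVneq (c i) 0.
  rewrite mul0r (_ : (fun _ => _) = cst 0); first exact: is_derive_cst.
  by apply/funext=> v; rewrite mul0r.
have [pi0 qi0] := cpq i c0.
have m0 : 0 < (1 - u) * q i + u * p i.
  have [->|u1'] := eqVneq u 1; first by rewrite subrr mul0r add0r mul1r.
  rewrite ltr_wpDr ?mulr_ge0 ?(ltW pi0) // mulr_gt0 //.
  by rewrite subr_gt0 lt_neqAle u1' u1.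
have h1 : is_derive u 1 (fun v => (1 - v) * q i + v * p i) (p i - q i).
  rewrite (_ : (fun v => _) = cst (q i) + (p i - q i) \*: (@id R)).
    by apply: is_derive_eq; rewrite add0r; exact: mulr1.
  apply/funext=> v; rewrite /cst /=; change ((1 - v) * q i + v * p i = q i + (p i - q i) * v).
  by ring.
have h2 := is_derive1_ln m0.
have h3 := @is_derive1_comp _ (@ln R) (fun v => (1 - v) * q i + v * p i) _ _ _ h2 h1.
rewrite (_ : (fun _ => _) = c i \*: (@ln R \o (fun v => (1 - v) * q i + v * p i))) //.
by apply: is_derive_eq; rewrite mulrC.
Qed.

(** The two sides are the increments of the two paths between [u = 0] and [u = 1]. The mean value
    theorem is applied to the difference of the paths, so derivatives need comparing only for
    [0 < u < 1]. *)
Lemma le_sum_ln_of_path (I J : finType) (c p q : I -> R) (c' p' q' : J -> R) :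
  (forall i, c i != 0 -> 0 < p i /\ 0 < q i) ->
  (forall j, c' j != 0 -> 0 < p' j /\ 0 < q' j) ->
  (forall u : R, 0 < u < 1 ->
    \sum_j c' j * ((p' j - q' j) / ((1 - u) * q' j + u * p' j)) <=
    \sum_i c i * ((p i - q i) / ((1 - u) * q i + u * p i))) ->
  \sum_j c' j * (ln (p' j) - ln (q' j)) <= \sum_i c i * (ln (p i) - ln (q i)).
Proof.
move=> h h' le_d; pose f : R -> R := lnpath c p q - lnpath c' p' q'.
pose df u := \sum_i c i * ((p i - q i) / ((1 - u) * q i + u * p i)) -
  \sum_j c' j * ((p' j - q' j) / ((1 - u) * q' j + u * p' j)).
have hd (u : R) : 0 <= u <= 1 -> is_derive u 1 f (df u).
  by move=> u01; apply: is_deriveB; exact: is_derive_lnpath.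
have := @MVT _ f df 0 1 ltr01.
case=> [u||u].
- by rewrite in_itv /= => /andP[u0 u1]; apply: hd; rewrite !ltW.
- apply: derivable_within_continuous => u; rewrite in_itv /= => /hd hu.
  exact: ex_derive.
rewrite in_itv /= => u01; rewrite subr0 mulr1 => e.
have : 0 <= f 1 - f 0 by rewrite e subr_ge0; exact: le_d.
have e1 (K : finType) (a b d : K -> R) :
    lnpath a b d 1 - lnpath a b d 0 = \sum_k a k * (ln (b k) - ln (d k)).
  rewrite /lnpath -sumrB; apply: eq_bigr=> k _.
  by rewrite subrr mul0r add0r mul1r subr0 mul1r mul0r addr0 mulrBr.
rewrite -!e1 /f; change (0 <= (lnpath c p q 1 - lnpath c' p' q' 1) - (lnpath c p q 0 - lnpath c' p' q' 0) -> lnpath c' p' q' 1 - lnpath c' p' q' 0 <= lnpath c p q 1 - lnpath c p q 0).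
by lra.
Qed.
End LogPath.

Lemma trace_conjl (F : comNzRingType) n (P P' D B : 'M[F]_n) :
  \tr (P' *m D *m P *m B) = \tr (D *m (P *m B *m P')).
Proof. by rewrite -!mulmxA mxtrace_mulC !mulmxA. Qed.

Section RelativeEntropy.
Variable R : realType.
Local Notation C := (R[i]).
Local Notation Re := (@complex.Re R).

Lemma ReD (x y : C) : Re (x + y) = Re x + Re y.
Proof. by case: x y => a b []. Qed.

Lemma ReB (x y : C) : Re (x - y) = Re x - Re y.
Proof. by case: x y => a b []. Qed.

Lemma Re_realM (a : R) (y : C) : Re (a%:C%C * y) = a * Re y.
Proof. by case: y => b c /=; rewrite mul0r subr0. Qed.

Lemma Re_sum (I : finType) (F : I -> C) : Re (\sum_i F i) = \sum_i Re (F i).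
Proof. by apply: (big_morph _ ReD). Qed.

(** * Relative entropy as a double sum over eigenvalues, and Klein's inequality *)

Definition suppmx n (X Y : 'M[C]_n) :=
  forall v : 'cV[C]_n, Y *m v = 0 -> X *m v = 0.

(** The finite branch of [relent], which equals it when [suppmx X Y] holds. *)
Definition drel n (X Y : 'M[C]_n) : R :=
  Re (\tr (X *m (fcalc (@ln R) X - fcalc (@ln R) Y))).

Lemma sum_overlap n (X Y : 'M[C]_n) f g :
  \sum_i \sum_j overlap X Y i j * (f (eigv X i) * g (eigv Y j)) =
  Re (\tr (fcalc f X *m fcalc g Y)).
Proof. by rewrite trace_fcalc2. Qed.

Lemma trace_overlapl n (X Y : 'M[C]_n) : adj X = X ->
  Re (\tr X) = \sum_i \sum_j overlap X Y i j * eigv X i.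
Proof.
move=> hX; rewrite -{1}(fcalc_id hX) -[in LHS](mulmx1 (fcalc id X)) -(fcalc1 Y) trace_fcalc2 /=.
by apply: eq_bigr=> i _; apply: eq_bigr=> j _; rewrite mulr1.
Qed.

Lemma trace_overlapr n (X Y : 'M[C]_n) : adj Y = Y ->
  Re (\tr Y) = \sum_i \sum_j overlap X Y i j * eigv Y j.
Proof.
move=> hX; rewrite -{1}(fcalc_id hX) -[in LHS](mul1mx (fcalc id Y)) -(fcalc1 X) trace_fcalc2 /=.
by apply: eq_bigr=> i _; apply: eq_bigr=> j _; rewrite mul1r.
Qed.

Lemma drelE n (X Y : 'M[C]_n) : adj X = X -> adj Y = Y ->
  drel X Y = \sum_i \sum_j (overlap X Y i j * eigv X i) * (ln (eigv X i) - ln (eigv Y j)).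
Proof.
move=> hX hY; rewrite /drel mulmxBr raddfB /= ReB.
have t1 : Re (\tr (X *m fcalc (@ln R) X)) =
    \sum_i \sum_j overlap X Y i j * (eigv X i * ln (eigv X i) * 1).
  by rewrite -{1}(fcalc_id hX) fcalcM -[fcalc _ X]mulmx1 -(fcalc1 Y) -sum_overlap.
have t2 : Re (\tr (X *m fcalc (@ln R) Y)) =
    \sum_i \sum_j overlap X Y i j * (eigv X i * ln (eigv Y j)).
  by rewrite -{1}(fcalc_id hX) -sum_overlap.
apply: etrans (congr2 (fun a b => a - b) t1 t2) _.
rewrite -sumrB; apply: eq_bigr=> i _; rewrite -sumrB.
by apply: eq_bigr=> j _; ring.
Qed.

(** If [eigv Y j = 0], the [j]-th eigenvector of [Y] lies in the kernel of [Y], hence in that of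
    [X]; its inner product with the [i]-th eigenvector of [X], times [eigv X i], is then zero. So
    the convention [ln 0 = 0] is never met at a nonzero weight. *)
Lemma eigv_supp n (X Y : 'M[C]_n) i j : psdmx X -> psdmx Y -> suppmx X Y ->
  overlap X Y i j * eigv X i != 0 -> 0 < eigv X i /\ 0 < eigv Y j.
Proof.
move=> pX pY s nz; have [hX hY] := (psdmx_hermitian pX, psdmx_hermitian pY).
have x0 : eigv X i != 0 by apply: contraNN nz => /eqP ->; rewrite mulr0.
split; first by rewrite lt_neqAle eq_sym x0 psdmx_eigv.
rewrite lt_neqAle psdmx_eigv // andbT; apply: contraNN nz => /eqP y0.
pose v := adj (spectralmx Y) *m (delta_mx j 0 : 'cV[C]_n).
have Yv : Y *m v = 0.
  rewrite {1}(hermitian_spectral hY) /v !mulmxA -(mulmxA _ (spectralmx Y)).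
  rewrite mul_spectral_adj mulmx1 -mulmxA (_ : _ *m delta_mx j 0 = 0) ?mulmx0 //.
  apply/matrixP=> a b; rewrite mul_dgmx_entry !mxE; case: eqVneq => [->|_].
    by rewrite -y0 mul0r.
  by rewrite mulr0.
have /(congr1 (fun M => (spectralmx X *m M) i 0)) := s v Yv.
rewrite {2}(hermitian_spectral hX) /v !mulmxA mul_spectral_adj mul1mx.
rewrite -!mulmxA (mulmxA (spectralmx X)) mul_dgmx_entry -colE mulmx0 !mxE.
set w := \sum_k _; move=> /eqP; rewrite mulf_eq0 => /orP[/eqP[/eqP]|].
  by rewrite (negPf x0).
move=> w0; rewrite mulf_eq0 -(inj_eq (@complexI R)) overlapE mxE -/w.
by rewrite (eqP w0) normr0 expr0n eqxx.
Qed.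

(** Each term satisfies [x * (ln x - ln y) >= x - y], and the right sides, weighted by the overlaps,
    sum to [tr X - tr Y = 0]. *)
Lemma klein n (X Y : 'M[C]_n) : psdmx X -> psdmx Y -> suppmx X Y ->
  \tr X = \tr Y -> 0 <= drel X Y.
Proof.
move=> pX pY s tXY; have [hX hY] := (psdmx_hermitian pX, psdmx_hermitian pY).
have : Re (\tr X) - Re (\tr Y) <= drel X Y; last by rewrite tXY subrr.
rewrite (trace_overlapl Y hX) (trace_overlapr X hY) (drelE hX hY).
rewrite -sumrB ler_sum // => i _; rewrite -sumrB ler_sum // => j _.
have [z|nz] := eqVneq (overlap X Y i j * eigv X i) 0.
  by rewrite z mul0r sub0r oppr_le0 mulr_ge0 ?overlap_ge0 ?psdmx_eigv.
have [x0 y0] := eigv_supp pX pY s nz.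
rewrite -mulrBr -mulrA ler_wpM2l ?overlap_ge0 //.
move: x0 y0; move: (eigv X i) (eigv Y j) => x y x0 y0.
(* This is [ln (1 + z) <= z] at [z = y / x - 1]. *)
have := @le_ln1Dx _ (y / x - 1); rewrite addrCA subrr addr0 ln_div ?posrE // => h.
have {}h : ln y - ln x <= y / x - 1 by apply: h; rewrite ltrBDl subrr divr_gt0.
have : x * (ln y - ln x) <= x * (y / x - 1) by rewrite ler_pM2l.
by rewrite !mulrBr mulr1 mulrCA divff ?gt_eqF // mulr1; lra.
Qed.

(** * The variational formula for the derivative along the path *)

Definition qform n u (X S Y : 'M[C]_n) : R :=
  2 * Re (\tr (X *m Y)) - (1 - u) * Re (\tr (S *m (Y *m adj Y)))
  - u * Re (\tr (X *m (adj Y *m Y))).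

(** The maximum of [qform u X S] over [Y]. A vanishing denominator is harmless: for [0 < u < 1] and
    positive [X], [S] it forces [eigv X i = 0]. *)
Definition qmax n u (X S : 'M[C]_n) : R :=
  \sum_i \sum_j (overlap X S i j * eigv X i) *
    (eigv X i / ((1 - u) * eigv S j + u * eigv X i)).

Lemma trace_dgmx_mul_adj n m (d : 'I_n -> R) (A B : 'M[C]_(n, m)) :
  \tr (dgmx d *m (A *m adj B)) = \sum_i \sum_j (d i)%:C%C * (A i j * (B i j)^*).
Proof.
rewrite /mxtrace; apply: eq_bigr=> i _; rewrite mul_dgmx_entry mxE mulr_sumr.
by apply: eq_bigr=> j _; rewrite adjmxE.
Qed.

(** With [Y] written through [Z] in the two eigenbases, the quadratic form decouples into one scalar
    problem for each entry of [Z]. *)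
Lemma qform_spectral n u (X S Z : 'M[C]_n) : adj X = X -> adj S = S ->
  let W := spectralmx X *m adj (spectralmx S) in
  qform u X S (adj (spectralmx S) *m adj Z *m spectralmx X) =
  \sum_i \sum_j (2 * (eigv X i * Re (W i j * (Z i j)^*))
    - ((1 - u) * eigv S j + u * eigv X i) * Re (Z i j * (Z i j)^*)).
Proof.
move=> hX hS W; rewrite /qform; set P := spectralmx X; set Q := spectralmx S.
set Y := adj Q *m adj Z *m P.
have aY : adj Y = adj P *m Z *m Q by rewrite !adjmxM !adjmxK mulmxA.
have e1 : \tr (X *m Y) = \sum_i \sum_j (eigv X i)%:C%C * (W i j * (Z i j)^*).
  rewrite -trace_dgmx_mul_adj {1}(hermitian_spectral hX) trace_conjl; congr (\tr (_ *m _)).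
  by rewrite /Y /W !mulmxA -mulmxA mul_spectral_adj mulmx1.
have e2 : \tr (X *m (adj Y *m Y)) =
    \sum_i \sum_j (eigv X i)%:C%C * (Z i j * (Z i j)^*).
  rewrite -trace_dgmx_mul_adj {1}(hermitian_spectral hX) trace_conjl; congr (\tr (_ *m _)).
  rewrite aY /Y !mulmxA mul_spectral_adj mul1mx -(mulmxA Z) mul_spectral_adj mulmx1.
  by rewrite -mulmxA mul_spectral_adj mulmx1.
have e3 : \tr (S *m (Y *m adj Y)) =
    \sum_j \sum_i (eigv S j)%:C%C * (adj Z j i * (adj Z j i)^*).
  rewrite -trace_dgmx_mul_adj {1}(hermitian_spectral hS) trace_conjl; congr (\tr (_ *m _)).
  rewrite aY adjmxK /Y !mulmxA mul_spectral_adj mul1mx -(mulmxA (adj Z)) mul_spectral_adj mulmx1.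
  by rewrite -mulmxA mul_spectral_adj mulmx1.
rewrite e1 e2 e3.
rewrite [X in (1 - u) * Re X]exchange_big /=.
rewrite !Re_sum !mulr_sumr -!sumrB; apply: eq_bigr=> i _.
rewrite !Re_sum !mulr_sumr -!sumrB; apply: eq_bigr=> j _.
rewrite adjmxE conjCK Re_realM Re_realM Re_realM [(Z i j)^* * _]mulrC.
by move: (Re _) (Re _) => a b; ring.
Qed.

(** Completing the square: the difference of the two sides is [m] times the squared modulus of
    [(p / m) w - z]. The next lemma is the case of equality. *)
Lemma Re_mul_conj_le (w z : C) (p m : R) : 0 < m ->
  2 * (p * Re (w * z^*)) - m * Re (z * z^*) <= Re (`|w| ^+ 2) * p * (p / m).
Proof.
move=> m0; rewrite -add_Re2_Im2 /=.
case: w z => a b [c d] /=.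
rewrite !mulrN !opprK -subr_ge0.
have -> : (a ^+ 2 + b ^+ 2) * p * (p / m) - (2 * (p * (a * c + b * d)) - m * (c * c + d * d))
  = m * ((a * p / m - c) ^+ 2 + (b * p / m - d) ^+ 2).
  by field; rewrite gt_eqF.
by rewrite mulr_ge0 ?(ltW m0) // addr_ge0 // sqr_ge0.
Qed.

Lemma Re_mul_conj_eq (w : C) (p m : R) : m != 0 ->
  2 * (p * Re (w * ((p / m)%:C%C * w)^*)) - m * Re ((p / m)%:C%C * w * ((p / m)%:C%C * w)^*)
  = Re (`|w| ^+ 2) * p * (p / m).
Proof.
move=> m0; rewrite -add_Re2_Im2 /=; case: w => a b /=; field => //.
Qed.

Lemma qform_le n u (X S Y : 'M[C]_n) : psdmx X -> psdmx S -> 0 < u < 1 ->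
  qform u X S Y <= qmax u X S.
Proof.
move=> pX pS /andP[u0 u1]; have [hX hS] := (psdmx_hermitian pX, psdmx_hermitian pS).
have -> : Y = adj (spectralmx S) *m adj (adj (spectralmx S *m Y *m adj (spectralmx X))) *m spectralmx X.
  rewrite adjmxK !mulmxA mul_adj_spectral mul1mx -mulmxA mul_adj_spectral mulmx1 //.
rewrite qform_spectral // /qmax ler_sum // => i _; rewrite ler_sum // => j _.
have x0 := psdmx_eigv i pX; have s0 := psdmx_eigv j pS.
have [m0|] := ltP 0 ((1 - u) * eigv S j + u * eigv X i); first exact: Re_mul_conj_le.
have [a0 b0] : 0 <= (1 - u) * eigv S j /\ 0 <= u * eigv X i.
  by split; apply: mulr_ge0 => //; lra.
(* The denominator is a sum of two nonnegative terms, so here both vanish. Then [eigv X i = 0] and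
   both sides are zero. *)
move=> mle; have -> : (1 - u) * eigv S j + u * eigv X i = 0 by lra.
have -> : eigv X i = 0.
  have /eqP : u * eigv X i = 0 by lra.
  by rewrite mulf_eq0 gt_eqF //= => /eqP.
by rewrite !(mulr0, mul0r) subr0.
Qed.

Lemma qform_max n u (X S : 'M[C]_n) : psdmx X -> psdmx S -> 0 < u < 1 ->
  exists Y, qform u X S Y = qmax u X S.
Proof.
move=> pX pS /andP[u0 u1]; have [hX hS] := (psdmx_hermitian pX, psdmx_hermitian pS).
(* The entrywise maximizer [(p / m) w] of the completed square; where the denominator is zero this
   gives the entry zero. *)
pose Z : 'M[C]_n := \matrix_(i, j) ((eigv X i / ((1 - u) * eigv S j + u * eigv X i))%:C%C *
   (spectralmx X *m adj (spectralmx S)) i j).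
exists (adj (spectralmx S) *m adj Z *m spectralmx X).
rewrite qform_spectral // /qmax; apply: eq_bigr=> i _; apply: eq_bigr=> j _.
rewrite [Z i j]mxE.
have [m0|m0] := eqVneq ((1 - u) * eigv S j + u * eigv X i) 0; last exact: Re_mul_conj_eq.
rewrite m0 invr0 !mulr0 (_ : 0%:C%C = 0 :> C) //.
by rewrite !mul0r conjC0 mulr0 /= !mulr0 subr0.
Qed.

(** * Trace-preserving Kraus maps and data processing *)

Section Kraus.
Variables (m n : nat) (I : finType) (K : I -> 'M[C]_(m, n)).
Hypothesis K1 : \sum_i adj (K i) *m K i = 1%:M.

Definition kraus (X : 'M[C]_n) : 'M[C]_m := \sum_i K i *m X *m adj (K i).

Let dual (Y : 'M[C]_m) : 'M[C]_n := \sum_i adj (K i) *m Y *m K i.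

Lemma trace_kraus X Y : \tr (kraus X *m Y) = \tr (X *m dual Y).
Proof.
rewrite mulmx_suml mulmx_sumr !raddf_sum /=; apply: eq_bigr=> i _.
by rewrite -!mulmxA mxtrace_mulC !mulmxA.
Qed.

Lemma adj_dual Y : adj (dual Y) = dual (adj Y).
Proof.
by rewrite /dual adjmx_sum; apply: eq_bigr=> i _; rewrite !adjmxM adjmxK mulmxA.
Qed.

Lemma kraus_trace X : \tr (kraus X) = \tr X.
Proof.
rewrite -[kraus X]mulmx1 trace_kraus /dual -[RHS]/(\tr X) -{2}(mulmx1 X) -K1.
by congr (\tr (_ *m _)); apply: eq_bigr=> i _; rewrite mulmx1.
Qed.

Lemma psdmx_kraus X : psdmx X -> psdmx (kraus X).
Proof. by move=> pX; apply: psdmx_sum => i; exact: psdmx_conj. Qed.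

Lemma psdmx_trace_mul_ge0 k l (X : 'M[C]_k) (M : 'M[C]_(k, l)) : psdmx X ->
  0 <= \tr (X *m (M *m adj M)).
Proof.
move=> /psdmx_factor[B ->].
rewrite -mulmxA mxtrace_mulC -!mulmxA.
have -> : adj B *m (M *m (adj M *m B)) = adj B *m M *m adj (adj B *m M).
  by rewrite adjmxM adjmxK !mulmxA.
rewrite /mxtrace sumr_ge0 // => i _; rewrite mxE sumr_ge0 // => j _.
by rewrite adjmxE mul_conjC_ge0.
Qed.

(* Schwarz inequality for [dual]: the difference is the sum of the
   [D i *m adj (D i)] with [D i := adj (K i) *m Y - dual Y *m adj (K i)]. *)
Lemma dual_schwarz X Y : psdmx X ->
  Re (\tr (X *m (dual Y *m adj (dual Y)))) <= Re (\tr (kraus X *m (Y *m adj Y))).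
Proof.
move=> pX; rewrite trace_kraus -subr_ge0 -ReB -raddfB /= -mulmxBr.
pose D i := adj (K i) *m Y - dual Y *m adj (K i).
have -> : dual (Y *m adj Y) - dual Y *m adj (dual Y) = \sum_i D i *m adj (D i).
  have e i : D i *m adj (D i) = adj (K i) *m (Y *m adj Y) *m K i
     - (adj (K i) *m Y *m K i) *m adj (dual Y)
     - dual Y *m (adj (K i) *m adj Y *m K i) + dual Y *m (adj (K i) *m K i) *m adj (dual Y).
    rewrite /D adjmxB !adjmxM !adjmxK mulmxBl !mulmxBr opprB !mulmxA.
    by rewrite [X in _ + X = _]addrC addrA.
  under eq_bigr do rewrite e.
  rewrite big_split /= sumrB sumrB -!mulmx_suml -!mulmx_sumr -/(dual _) K1 mulmx1.
  by rewrite -/(dual (adj Y)) -adj_dual -/(dual Y) addrNK.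
rewrite mulmx_sumr [\tr _]raddf_sum Re_sum sumr_ge0 // => i _.
by have := psdmx_trace_mul_ge0 (D i) pX; rewrite lecE /= => /andP[].
Qed.

(** Duality carries the linear term over exactly. The quadratic terms are bounded by [dual_schwarz],
    used at [Y] for [S] and at [adj Y] for [X]. *)
Lemma qform_kraus u X S Y : psdmx X -> psdmx S -> 0 < u < 1 ->
  qform u (kraus X) (kraus S) Y <= qform u X S (dual Y).
Proof.
move=> pX pS /andP[u0 u1]; rewrite /qform trace_kraus.
have h1 := dual_schwarz Y pS.
have h2 := dual_schwarz (adj Y) pX.
rewrite adjmxK -adj_dual adjmxK in h2.
by rewrite !lerB // ler_pM2l ?subr_gt0.
Qed.

(** The dual of a maximizer for the image pair is a competitor for the original pair. *)
Lemma qmax_kraus u X S : psdmx X -> psdmx S -> 0 < u < 1 ->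
  qmax u (kraus X) (kraus S) <= qmax u X S.
Proof.
move=> pX pS u01; have [Y <-] := qform_max (psdmx_kraus pX) (psdmx_kraus pS) u01.
by apply: le_trans (qform_kraus Y pX pS u01) _; exact: qform_le.
Qed.

(** If [v] is in the kernel of [kraus S], the nonnegative numbers [<K_i^dag v|S|K_i^dag v>] sum to
    zero. So each [K_i^dag v] is in the kernel of [S], hence of [X]. *)
Lemma suppmx_kraus X S : psdmx S -> suppmx X S -> suppmx (kraus X) (kraus S).
Proof.
move=> pS s v Sv0.
have h i : S *m (adj (K i) *m v) = 0.
  apply: psdmx_ker => //.
  have : (adj v *m kraus S *m v) 0 0 = 0 by rewrite -mulmxA Sv0 mulmx0 mxE.
  rewrite mulmx_sumr mulmx_suml summxE => /eqP; rewrite psumr_eq0 => [/allP/(_ i)|j _].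
    by rewrite mem_index_enum => /(_ isT)/eqP; rewrite adjmxM adjmxK !mulmxA.
  exact: (psdmx_conj (K j) pS).
rewrite mulmx_suml big1 // => i _.
by rewrite -!mulmxA s // mulmx0.
Qed.

Theorem drel_kraus X S : psdmx X -> psdmx S -> suppmx X S ->
  drel (kraus X) (kraus S) <= drel X S.
Proof.
move=> pX pS s; have s' := suppmx_kraus pS s.
have [pX' pS'] := (psdmx_kraus pX, psdmx_kraus pS).
rewrite !drelE; try exact: psdmx_hermitian.
rewrite !pair_bigA /=.
apply: (@le_sum_ln_of_path R _ _
  (fun a => overlap X S a.1 a.2 * eigv X a.1) (fun a => eigv X a.1) (fun a => eigv S a.2)
  (fun a => overlap (kraus X) (kraus S) a.1 a.2 * eigv (kraus X) a.1)
  (fun a => eigv (kraus X) a.1) (fun a => eigv (kraus S) a.2)).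
- by move=> a; exact: eigv_supp.
- by move=> a; exact: eigv_supp.
move=> u /[dup] u01 /andP[u0 u1].
(* With [m = (1 - u) q + u p] one has [p (p - q) / m = (p^2 / m - p) / (1 - u)], so the derivative
   of the path is [qmax] up to the trace, which the Kraus map preserves. *)
have e k (Z T : 'M[C]_k) : psdmx Z -> psdmx T -> suppmx Z T ->
  \sum_(a : 'I_k * 'I_k) overlap Z T a.1 a.2 * eigv Z a.1 *
    ((eigv Z a.1 - eigv T a.2) / ((1 - u) * eigv T a.2 + u * eigv Z a.1))
  = (qmax u Z T - Re (\tr Z)) / (1 - u).
  move=> pZ pT sZT; rewrite (trace_overlapl T (psdmx_hermitian pZ)) /qmax !pair_bigA /=.
  rewrite -sumrB mulr_suml; apply: eq_bigr=> -[a b] _ /=.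
  have [->|nz] := eqVneq (overlap Z T a b * eigv Z a) 0; first by rewrite !mul0r subrr mul0r.
  have [z0 t0] := eigv_supp pZ pT sZT nz.
  field; rewrite subr_eq0 gt_eqF //= gt_eqF // ltr_wpDr ?mulr_ge0 ?ltW //.
  by rewrite mulr_gt0 ?subr_gt0.
rewrite !e // kraus_trace ler_pM2r ?invr_gt0 ?subr_gt0 // lerB //.
exact: qmax_kraus.
Qed.

End Kraus.
End RelativeEntropy.

(** * Operators indexed by finite types *)

Lemma sum_delta_l (F : pzSemiRingType) (T : finType) (x : T) (f : T -> F) :
  \sum_t (x == t)%:R * f t = f x.
Proof.
rewrite (bigD1 x) //= eqxx mul1r big1 ?addr0 // => t /negPf.
by rewrite eq_sym => ->; rewrite mul0r.
Qed.

Lemma sum_delta_r (F : pzSemiRingType) (T : finType) (x : T) (f : T -> F) :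
  \sum_t f t * (x == t)%:R = f x.
Proof.
rewrite (bigD1 x) //= eqxx mulr1 big1 ?addr0 // => t /negPf.
by rewrite eq_sym => ->; rewrite mulr0.
Qed.

Section Entries.
Variable R : realType.
Local Notation C := (R[i]).
Local Notation Re := (@complex.Re R).
Local Notation op := (op R).

(** Rectangular counterpart of [ent], for matrices between different systems such as [graphmx] and
    [incl]. *)
Definition rent (S T : finType) (X : 'M[C]_(#|S|, #|T|)) (s : S) (t : T) : C :=
  X (enum_rank s) (enum_rank t).

Definition rmk (S T : finType) (f : S -> T -> C) : 'M[C]_(#|S|, #|T|) :=
  \matrix_(i, j) f (enum_val i) (enum_val j).

Lemma entE (T : finType) (X : op T) x y : ent X x y = rent X x y.
Proof. by []. Qed.

Lemma rent_rmk (S T : finType) (f : S -> T -> C) s t : rent (rmk f) s t = f s t.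
Proof. by rewrite /rent mxE !enum_rankK. Qed.

Lemma rent_mkop (T : finType) (f : T -> T -> C) s t : rent (mkop f) s t = f s t.
Proof. exact: rent_rmk. Qed.

Lemma rentP (S T : finType) (X Y : 'M[C]_(#|S|, #|T|)) :
  (forall s t, rent X s t = rent Y s t) -> X = Y.
Proof.
by move=> h; apply/matrixP=> i j; have := h (enum_val i) (enum_val j); rewrite /rent !enum_valK.
Qed.

Lemma rent_mul (S T V : finType) (X : 'M[C]_(#|S|, #|T|)) (Y : 'M[C]_(#|T|, #|V|)) s v :
  rent (X *m Y) s v = \sum_t rent X s t * rent Y t v.
Proof. by rewrite /rent mxE (reindex (@enum_rank T)) //; exact/onW_bij/enum_rank_bij. Qed.

Lemma rent_adj (S T : finType) (X : 'M[C]_(#|S|, #|T|)) s t :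
  rent (adj X) t s = (rent X s t)^*.
Proof. by rewrite /rent adjmxE. Qed.

Lemma rent1 (T : finType) (s t : T) : rent (1%:M : op T) s t = (s == t)%:R.
Proof. by rewrite /rent mxE (inj_eq enum_rank_inj). Qed.

Lemma rentD (S T : finType) (X Y : 'M[C]_(#|S|, #|T|)) s t :
  rent (X + Y) s t = rent X s t + rent Y s t.
Proof. by rewrite /rent mxE. Qed.

Lemma rentZ (S T : finType) c (X : 'M[C]_(#|S|, #|T|)) s t :
  rent (c *: X) s t = c * rent X s t.
Proof. by rewrite /rent mxE. Qed.

Lemma rent_sum (S T I : finType) (F : I -> 'M[C]_(#|S|, #|T|)) s t :
  rent (\sum_i F i) s t = \sum_i rent (F i) s t.
Proof. by rewrite /rent summxE. Qed.

Lemma trace_rent (T : finType) (X : op T) : \tr X = \sum_t rent X t t.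
Proof. by rewrite /mxtrace (reindex (@enum_rank T)) //; exact/onW_bij/enum_rank_bij. Qed.

Lemma rent_tens (S T : finType) (X : op S) (Y : op T) u v :
  rent (tens X Y) u v = rent X u.1 v.1 * rent Y u.2 v.2.
Proof. exact: rent_mkop. Qed.

Lemma rent_ptr1 (S T : finType) (X : op (S * T)%type) t t' :
  rent (ptr1 X) t t' = \sum_s rent X (s, t) (s, t').
Proof. exact: rent_mkop. Qed.

Lemma rent_ptr2 (S T : finType) (X : op (S * T)%type) s s' :
  rent (ptr2 X) s s' = \sum_t rent X (s, t) (s', t).
Proof. exact: rent_mkop. Qed.

Lemma rent_relabel (S T : finType) (e : T -> S) (X : op S) x y :
  rent (relabel e X) x y = rent X (e x) (e y).
Proof. exact: rent_mkop. Qed.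

Lemma rent_eunit (T : finType) (x y a b : T) :
  rent (eunit R x y) a b = ((x == a) && (y == b))%:R.
Proof. by rewrite rent_mkop !(eq_sym a, eq_sym b). Qed.

(** The block [<r|X|r'>]; [idt K] applies [K] to each of these blocks. *)
Definition slice (Rf S : finType) (X : op (Rf * S)%type) r r' : op S :=
  mkop (fun s s' => ent X (r, s) (r', s')).

Lemma rent_slice (Rf S : finType) (X : op (Rf * S)%type) r r' s s' :
  rent (slice X r r') s s' = rent X (r, s) (r', s').
Proof. exact: rent_mkop. Qed.

Lemma rent_idt (Rf S T : finType) (K : op S -> op T) (X : op (Rf * S)%type) u v :
  rent (idt K X) u v = rent (K (slice X u.1 v.1)) u.2 v.2.
Proof. exact: rent_mkop. Qed.

Lemma rent_maxent (T : finType) u v :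
  rent (maxent R T) u v = ((u.1 == u.2) && (v.1 == v.2))%:R / #|T|%:R.
Proof. exact: rent_mkop. Qed.

Lemma slice_maxent (T : finType) (x y : T) :
  slice (maxent R T) x y = #|T|%:R^-1 *: eunit R x y.
Proof. by apply: rentP=> s t; rewrite rent_slice rentZ rent_maxent rent_eunit mulrC. Qed.

Lemma trace_eunit (T : finType) (x y : T) : \tr (eunit R x y) = (x == y)%:R.
Proof.
rewrite trace_rent (eq_bigr (fun t => (x == t)%:R * (y == t)%:R)).
  by rewrite sum_delta_l eq_sym.
by move=> t _; rewrite rent_eunit -natrM mulnb.
Qed.

Lemma trace_ptr1 (S T : finType) (X : op (S * T)%type) : \tr (ptr1 X) = \tr X.
Proof.
rewrite !trace_rent; under eq_bigr do rewrite rent_ptr1.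
by rewrite exchange_big pair_bigA; apply: eq_bigr=> -[].
Qed.

Lemma trace_ptr2 (S T : finType) (X : op (S * T)%type) : \tr (ptr2 X) = \tr X.
Proof.
rewrite !trace_rent; under eq_bigr do rewrite rent_ptr2.
by rewrite pair_bigA; apply: eq_bigr=> -[].
Qed.

Lemma trace_tens (S T : finType) (X : op S) (Y : op T) : \tr (tens X Y) = \tr X * \tr Y.
Proof.
rewrite !trace_rent mulr_suml; under [RHS]eq_bigr do rewrite mulr_sumr.
by rewrite pair_bigA; apply: eq_bigr=> -[a b] _; rewrite rent_tens.
Qed.

Lemma mul_tens (S T : finType) (X X' : op S) (Y Y' : op T) :
  tens X Y *m tens X' Y' = tens (X *m X') (Y *m Y').
Proof.
apply: rentP=> -[a b] [c d]; rewrite rent_tens !rent_mul mulr_suml.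
under [RHS]eq_bigr do rewrite mulr_sumr.
by rewrite pair_bigA; apply: eq_bigr=> -[x y] _; rewrite !rent_tens /=; ring.
Qed.

Lemma adj_tens (S T : finType) (X : op S) (Y : op T) : adj (tens X Y) = tens (adj X) (adj Y).
Proof. by apply: rentP=> a b; rewrite !(rent_adj, rent_tens) rmorphM. Qed.

Lemma tens11 (S T : finType) : tens (1%:M : op S) (1%:M : op T) = 1%:M.
Proof. by apply: rentP=> -[a b] [c d]; rewrite rent_tens !rent1 -natrM mulnb. Qed.

Lemma unitary_tens (S T : finType) (X : op S) (Y : op T) :
  unitary X -> unitary Y -> unitary (tens X Y).
Proof. by rewrite /unitary adj_tens mul_tens => -> ->; rewrite tens11. Qed.

Lemma uconj_tens (S T : finType) (X X' : op S) (Y Y' : op T) :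
  uconj (tens X Y) (tens X' Y') = tens (uconj X X') (uconj Y Y').
Proof. by rewrite /uconj adj_tens !mul_tens. Qed.

Lemma unitaryC (T : finType) (U : op T) : unitary U -> adj U *m U = 1%:M.
Proof. exact: mulmx1C. Qed.

Lemma unitary_ent (T : finType) (U : op T) c c' : unitary U ->
  \sum_a rent U c a * (rent U c' a)^* = (c == c')%:R.
Proof.
move=> /(congr1 (fun M => rent M c c')); rewrite rent_mul rent1 => <-.
by apply: eq_bigr=> a _; rewrite rent_adj.
Qed.

(** Writes [relabel] as a congruence, which gives positivity for every [e]; for bijective [e] it is
    a permutation matrix. *)
Definition graphmx (S T : finType) (e : T -> S) : 'M[C]_(#|T|, #|S|) :=
  rmk (fun t s => (e t == s)%:R).

Lemma relabelE (S T : finType) (e : T -> S) (X : op S) :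
  relabel e X = graphmx e *m X *m adj (graphmx e).
Proof.
apply: rentP=> a b; rewrite rent_relabel rent_mul.
under eq_bigr do rewrite rent_adj rent_rmk rmorph_nat.
rewrite sum_delta_r rent_mul; under eq_bigr do rewrite rent_rmk.
by rewrite sum_delta_l.
Qed.

Lemma psd_relabel (S T : finType) (e : T -> S) (X : op S) : psd X -> psd (relabel e X).
Proof. by rewrite relabelE; exact: psdmx_conj. Qed.

Lemma relabel_comp (S T V : finType) (e : T -> S) (f : V -> T) (X : op S) :
  relabel f (relabel e X) = relabel (e \o f) X.
Proof. by apply: rentP=> a b; rewrite !rent_relabel. Qed.

(** * Invariance of entropies and supports under reordering of tensor factors *)

Section Bijection.
Variables (S T : finType) (e : T -> S).
Hypothesis bij_e : bijective e.

Lemma trace_relabel (X : op S) : \tr (relabel e X) = \tr X.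
Proof.
rewrite !trace_rent [RHS](reindex e) /=; last exact/onW_bij.
by apply: eq_bigr=> t _; rewrite rent_relabel.
Qed.

Lemma relabelM (X Y : op S) : relabel e (X *m Y) = relabel e X *m relabel e Y.
Proof.
apply: rentP=> a b; rewrite rent_relabel !rent_mul (reindex e) /=; last exact/onW_bij.
by apply: eq_bigr=> t _; rewrite !rent_relabel.
Qed.

Lemma relabelB (X Y : op S) : relabel e (X - Y) = relabel e X - relabel e Y.
Proof. by rewrite !relabelE mulmxBr mulmxBl. Qed.

Lemma relabel_adj (X : op S) : relabel e (adj X) = adj (relabel e X).
Proof. by apply: rentP=> a b; rewrite !(rent_adj, rent_relabel). Qed.

Lemma graphmx_adj_mul : adj (graphmx e) *m graphmx e = 1%:M.
Proof.
apply: rentP=> a b; rewrite rent_mul rent1.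
have [f ef fe] := bij_e.
under eq_bigr do rewrite rent_adj !rent_rmk rmorph_nat.
rewrite (reindex f) /=; last by apply/onW_bij; exists e.
under eq_bigr do rewrite fe eq_sym.
by rewrite sum_delta_l.
Qed.

Lemma fcalc_relabel f (X : op S) : adj X = X ->
  fcalc f (relabel e X) = relabel e (fcalc f X).
Proof.
move=> hX.
have h : relabel e X *m graphmx e = graphmx e *m X.
  by rewrite relabelE -!mulmxA graphmx_adj_mul mulmx1.
have := fcalc_intertwine f _ hX h; rewrite -relabel_adj hX => /(_ erefl) h'.
have g1 : graphmx e *m adj (graphmx e) = 1%:M.
  rewrite -[X in X *m _]mulmx1 -relabelE; apply: rentP=> a b.
  by rewrite rent_relabel !rent1 (bij_eq bij_e).
by rewrite [RHS]relabelE -h' -mulmxA g1 mulmx1.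
Qed.

Lemma vNent_relabel (X : op S) : adj X = X -> vNent (relabel e X) = vNent X.
Proof.
move=> hX; rewrite /vNent; congr (- Re _).
by rewrite !logmE fcalc_relabel // -relabelM trace_relabel.
Qed.

Lemma drel_relabel (X Y : op S) : adj X = X -> adj Y = Y ->
  drel (relabel e X) (relabel e Y) = drel X Y.
Proof.
move=> hX hY; rewrite /drel (fcalc_relabel _ hX) (fcalc_relabel _ hY).
by rewrite -relabelB -relabelM trace_relabel.
Qed.

Lemma suppmx_relabel (X Y : op S) : suppmx (relabel e X) (relabel e Y) <-> suppmx X Y.
Proof.
split=> h.
  move=> v Yv; have := h (graphmx e *m v).
  rewrite !relabelE -!mulmxA !(mulmxA (adj _)) graphmx_adj_mul mul1mx Yv mulmx0 => /(_ erefl).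
  by move=> /(congr1 (mulmx (adj (graphmx e)))); rewrite mulmxA graphmx_adj_mul mul1mx mulmx0.
move=> v; rewrite !relabelE -!mulmxA => /(congr1 (mulmx (adj (graphmx e)))).
by rewrite mulmxA graphmx_adj_mul mul1mx mulmx0 => /h ->; rewrite mulmx0.
Qed.

End Bijection.

(** * Partial trace over, and identity on, the first tensor factor *)

Section Blocks.
Variables S T : finType.

(** The isometry [|s> (x) 1]. These are the Kraus operators of [X |-> 1 (x) X], and their adjoints
    are those of the partial trace. *)
Definition incl (s : S) : 'M[C]_(#|{: S * T}|, #|T|) :=
  rmk (fun u t => ((u.1 == s) && (u.2 == t))%:R).

Lemma mul_incl (Z : finType) (X : 'M[C]_(#|Z|, #|{: S * T}|)) s z t :
  rent (X *m incl s) z t = rent X z (s, t).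
Proof.
rewrite rent_mul (bigD1 (s, t)) //= rent_rmk /= !eqxx mulr1 big1 ?addr0 // => -[a b].
by rewrite xpair_eqE rent_rmk /= => /negPf ->; rewrite mulr0.
Qed.

Lemma mul_adj_incl (Z : finType) (X : 'M[C]_(#|{: S * T}|, #|Z|)) s t z :
  rent (adj (incl s) *m X) t z = rent X (s, t) z.
Proof.
rewrite rent_mul (bigD1 (s, t)) //= rent_adj rent_rmk /= !eqxx conjC1 mul1r big1 ?addr0 // => -[a b].
by rewrite xpair_eqE rent_adj rent_rmk /= => /negPf ->; rewrite conjC0 mul0r.
Qed.

Lemma ptr1E (X : op (S * T)%type) : ptr1 X = \sum_s adj (incl s) *m X *m incl s.
Proof.
apply: rentP=> a b; rewrite rent_ptr1 rent_sum; apply: eq_bigr=> s _.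
by rewrite mul_incl mul_adj_incl.
Qed.

Lemma tens1E (X : op T) : tens (1%:M : op S) X = \sum_s incl s *m X *m adj (incl s).
Proof.
apply: rentP=> -[a b] [c d]; rewrite rent_tens rent_sum rent1 /=.
rewrite (eq_bigr (fun s => (a == s)%:R * ((c == s)%:R * rent X b d))).
  by rewrite sum_delta_l eq_sym.
move=> s _; rewrite rent_mul.
under eq_bigr do rewrite rent_adj rent_rmk rmorph_nat /= -mulnb natrM mulrCA.
rewrite -mulr_sumr sum_delta_r rent_mul.
under eq_bigr do rewrite rent_rmk /= -mulnb natrM -mulrA.
by rewrite -mulr_sumr sum_delta_l mulrCA.
Qed.

Lemma psd_ptr1 (X : op (S * T)%type) : psd X -> psd (ptr1 X).
Proof.
move=> pX; rewrite ptr1E; apply: psdmx_sum => s.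
by have := psdmx_conj (adj (incl s)) pX; rewrite adjmxK.
Qed.

Lemma psd_tens1 (X : op T) : psd X -> psd (tens (1%:M : op S) X).
Proof. by move=> pX; rewrite tens1E; apply: psdmx_sum => s; exact: psdmx_conj. Qed.

Lemma tens1_incl (X : op T) s : tens (1%:M : op S) X *m incl s = incl s *m X.
Proof.
apply: rentP=> -[a b] t; rewrite mul_incl rent_tens rent1 rent_mul /=.
under eq_bigr do rewrite rent_rmk /= -mulnb natrM -mulrA.
by rewrite -mulr_sumr sum_delta_l.
Qed.

(** Each [incl s] intertwines [X] with [1 (x) X], and together they reach all columns. *)
Lemma fcalc_tens1 f (X : op T) : adj X = X ->
  fcalc f (tens (1%:M : op S) X) = tens (1%:M : op S) (fcalc f X).
Proof.
move=> hX; apply: rentP=> a [s t]; rewrite -mul_incl.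
rewrite (fcalc_intertwine f _ hX (tens1_incl X s)); last by rewrite adj_tens adjmx1 hX.
by rewrite -tens1_incl mul_incl.
Qed.

Lemma trace_mul_tens1 (X : op (S * T)%type) (Y : op T) :
  \tr (X *m tens (1%:M : op S) Y) = \tr (ptr1 X *m Y).
Proof.
rewrite tens1E ptr1E mulmx_sumr mulmx_suml !raddf_sum; apply: eq_bigr=> s _ /=.
by rewrite mulmxA mxtrace_mulC !mulmxA.
Qed.

(* A vector killed by [1 (x) ptr1 X] has blocks [v_s] with [<v_s|ptr1 X|v_s> = 0], and this is
   the sum over [s'] of the nonnegative numbers [<s' v_s|X|s' v_s>]. *)
Lemma suppmx_ptr1 (X : op (S * T)%type) : psd X -> suppmx X (tens (1%:M : op S) (ptr1 X)).
Proof.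
move=> pX v v0.
have vE : v = \sum_s incl s *m (adj (incl s) *m v).
  rewrite -{1}[v]mul1mx -tens11 tens1E mulmx_suml; apply: eq_bigr=> s _.
  by rewrite mulmx1 mulmxA.
have h s : ptr1 X *m (adj (incl s) *m v) = 0.
  have : adj (tens (1%:M : op S) (adj (ptr1 X)) *m incl s) *m v = 0.
    by rewrite adjmxM adj_tens adjmx1 adjmxK -mulmxA v0 mulmx0.
  by rewrite tens1_incl adjmxM adjmxK mulmxA.
have key s (w : 'cV[C]_#|T|) : ptr1 X *m w = 0 -> X *m (incl s *m w) = 0.
  move=> hw; apply: psdmx_ker => //.
  have e i : (adj w *m (adj (incl i) *m X *m incl i) *m w) 0 0 =
             (adj (incl i *m w) *m X *m (incl i *m w)) 0 0.
    by rewrite adjmxM !mulmxA.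
  have : (adj w *m ptr1 X *m w) 0 0 = 0 by rewrite -mulmxA hw mulmx0 mxE.
  rewrite ptr1E mulmx_sumr mulmx_suml summxE => /eqP; rewrite psumr_eq0 => [|i _].
    by move=> /allP/(_ s); rewrite mem_index_enum => /(_ isT)/eqP; rewrite e.
  by rewrite e; exact: pX.
by rewrite vE mulmx_sumr big1 // => s _; exact: key.
Qed.

Lemma suppmx_tens1 (X : op (S * T)%type) (Y : op T) :
  suppmx X (tens (1%:M : op S) Y) -> suppmx (ptr1 X) Y.
Proof.
move=> h v Yv; rewrite ptr1E mulmx_suml big1 // => s _.
rewrite -!mulmxA (h (incl s *m v)) ?mulmx0 //.
by rewrite mulmxA tens1_incl -mulmxA Yv mulmx0.
Qed.

End Blocks.
End Entries.

(** * Linear maps, complete positivity and scaled reference operators *)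

Section Maps.
Variable R : realType.
Local Notation C := (R[i]).
Local Notation Re := (@complex.Re R).
Local Notation op := (op R).

Section Linear.
Variables (S T : finType) (K : op S -> op T).
Hypothesis linK : is_linear_map K.

Lemma is_linear0 : K 0 = 0.
Proof.
have := linK 1 0 0; rewrite !scale1r addr0 => /(congr1 (fun M => M - K 0)).
by rewrite addrK subrr.
Qed.

Lemma is_linearZ c X : K (c *: X) = c *: K X.
Proof. by have := linK c X 0; rewrite addr0 is_linear0 addr0. Qed.

Lemma is_linearD X Y : K (X + Y) = K X + K Y.
Proof. by have := linK 1 X Y; rewrite !scale1r. Qed.

Lemma is_linearB X Y : K (X - Y) = K X - K Y.
Proof. by rewrite -scaleN1r is_linearD is_linearZ scaleN1r. Qed.

Lemma is_linear_sum (I : finType) (F : I -> op S) : K (\sum_i F i) = \sum_i K (F i).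
Proof. exact: (big_morph K is_linearD is_linear0). Qed.

End Linear.

Lemma op_eunit (S : finType) (X : op S) : X = \sum_x \sum_y rent X x y *: eunit R x y.
Proof.
apply: rentP=> a b; rewrite rent_sum.
rewrite (eq_bigr (fun x => (a == x)%:R * rent X x b)) ?sum_delta_l // => x _.
rewrite rent_sum (eq_bigr (fun y => (a == x)%:R * ((b == y)%:R * rent X x y))).
  by rewrite -mulr_sumr sum_delta_l.
by move=> y _; rewrite rentZ rent_eunit -mulnb natrM eq_sym [y == b]eq_sym; ring.
Qed.

Lemma is_linear_eunit (S T : finType) (K : op S -> op T) X : is_linear_map K ->
  K X = \sum_x \sum_y rent X x y *: K (eunit R x y).
Proof.
move=> linK; rewrite {1}(op_eunit X) (is_linear_sum linK); apply: eq_bigr=> x _.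
by rewrite (is_linear_sum linK); apply: eq_bigr=> y _; rewrite (is_linearZ linK).
Qed.

Lemma eunitE (S : finType) (x y : S) :
  eunit R x y = delta_mx (enum_rank x) 0 *m adj (delta_mx (enum_rank y) 0 : 'cV[C]_#|S|).
Proof.
apply/matrixP=> i j; rewrite !mxE big_ord1 !mxE !andbT rmorph_nat -natrM mulnb.
by rewrite -(inj_eq enum_val_inj) -[j == _](inj_eq enum_val_inj) !enum_rankK.
Qed.

(** Expresses a matrix unit through positive rank-one operators, as [is_linear_ext] requires. *)
Lemma rank1_polarization n (v w : 'cV[C]_n) : v *m adj w = 2^-1 *:
  ((v + w) *m adj (v + w) + 'i *: ((v + 'i *: w) *m adj (v + 'i *: w))
   - (1 + 'i) *: (v *m adj v + w *m adj w)).
Proof.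
apply/matrixP=> i j; rewrite !adjmxD adjmxZ conjCi !mxE !big_ord1 !mxE.
have i2 : 'i * 'i = -1 :> C by rewrite -expr2 sqrCi.
move: (v i 0) (w i 0) ((v j 0)^*) ((w j 0)^*) => a b c d.
have -> : (a + b) * (c + d) + 'i * ((a + 'i * b) * (c + - 'i * d)) - (1 + 'i) * (a * c + b * d)
  = (1 - 'i * 'i) * (a * d) + (1 + 'i * 'i) * (b * c) - 'i * (1 + 'i * 'i) * (b * d).
  by ring.
rewrite i2 subrr mulr0 !mul0r addr0 subr0 opprK mulrA -{2}[1]/1%:R.
by rewrite (_ : 1 + 1 = 2) // mulVf ?mul1r // pnatr_eq0.
Qed.

(** A nonzero [v *m adj v] is a multiple of a density, and polarization reaches the matrix units
    from these. This extends a covariance known on states to all operators. *)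
Lemma is_linear_ext (S T : finType) (F G : op S -> op T) :
  is_linear_map F -> is_linear_map G -> (forall X, density X -> F X = G X) ->
  forall X, F X = G X.
Proof.
move=> linF linG h X.
have h1 (v : 'cV[C]_#|S|) : F (v *m adj v) = G (v *m adj v).
  have t : \tr (v *m adj v) = (adj v *m v) 0 0.
    by rewrite mxtrace_mulC /mxtrace big_ord1.
  have [/mul_adj_eq0 ->|nz] := eqVneq ((adj v *m v) 0 0) 0.
    by rewrite mul0mx (is_linear0 linF) (is_linear0 linG).
  have {}h := h (((adj v *m v) 0 0)^-1 *: (v *m adj v)).
  have : F (((adj v *m v) 0 0)^-1 *: (v *m adj v)) = G (((adj v *m v) 0 0)^-1 *: (v *m adj v)).
    apply: h; split; last by rewrite mxtraceZ t mulVf.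
    by apply: psdmx_scale; [rewrite invr_ge0 mul_adj_ge0|exact: psdmx_mul_adj].
  rewrite (is_linearZ linF) (is_linearZ linG) => /(congr1 (fun M => (adj v *m v) 0 0 *: M)).
  by rewrite !scalerA divff // !scale1r.
have h2 x y : F (eunit R x y) = G (eunit R x y).
  rewrite eunitE rank1_polarization.
  rewrite (is_linearZ linF) (is_linearB linF) (is_linearD linF) 2!(is_linearZ linF).
  rewrite (is_linearZ linG) (is_linearB linG) (is_linearD linG) 2!(is_linearZ linG).
  by rewrite (is_linearD linF) (is_linearD linG) !h1.
rewrite (is_linear_eunit X linF) (is_linear_eunit X linG).
by apply: eq_bigr=> x _; apply: eq_bigr=> y _; rewrite h2.
Qed.

Lemma uconj_linear (S : finType) (U : op S) : is_linear_map (uconj U).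
Proof. by move=> a X Y; rewrite /uconj mulmxDr mulmxDl -scalemxAr -scalemxAl. Qed.

Lemma comp_linear (S T V : finType) (F : op T -> op V) (G : op S -> op T) :
  is_linear_map F -> is_linear_map G -> is_linear_map (fun X => F (G X)).
Proof. by move=> linF linG a X Y; rewrite linG linF. Qed.

Lemma ptr1_linear (S T : finType) : is_linear_map (@ptr1 R S T).
Proof.
move=> a X Y; apply: rentP=> s t; rewrite rentD rentZ !rent_ptr1 mulr_sumr -big_split.
by apply: eq_bigr=> u _; rewrite rentD rentZ.
Qed.

Lemma ptr2_linear (S T : finType) : is_linear_map (@ptr2 R S T).
Proof.
move=> a X Y; apply: rentP=> s t; rewrite rentD rentZ !rent_ptr2 mulr_sumr -big_split.
by apply: eq_bigr=> u _; rewrite rentD rentZ.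
Qed.

Lemma relabel_linear (S T : finType) (e : T -> S) : is_linear_map (@relabel R S T e).
Proof. by move=> a X Y; apply: rentP=> s t; rewrite !(rent_relabel, rentD, rentZ). Qed.

Lemma tens_linear (S T : finType) (Z : op S) : is_linear_map (@tens R S T Z).
Proof. by move=> a X Y; apply: rentP=> s t; rewrite !(rent_tens, rentD, rentZ); ring. Qed.

(** Complete positivity is stated for references ['I_n]; enumerating [Rf] transfers it to any finite
    type. *)
Lemma psd_idt (Rf S T : finType) (K : op S -> op T) (X : op (Rf * S)%type) :
  completely_positive K -> psd X -> psd (idt K X).
Proof.
move=> cpK pX; pose e (u : 'I_#|Rf| * S) : Rf * S := (enum_val u.1, u.2).
pose e' (u : Rf * T) : 'I_#|Rf| * T := (enum_rank u.1, u.2).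
have -> : idt K X = relabel e' (idt K (relabel e X)).
  apply: rentP=> u v; rewrite rent_relabel !rent_idt /=; congr (rent (K _) _ _).
  by apply: rentP=> s t; rewrite !rent_slice rent_relabel /e /= !enum_rankK.
exact/psd_relabel/cpK/psd_relabel.
Qed.

Lemma trace_rent_pair (S T : finType) (X : op (S * T)%type) :
  \tr X = \sum_s \sum_t rent X (s, t) (s, t).
Proof. by rewrite trace_rent pair_bigA; apply: eq_bigr=> -[]. Qed.

Lemma trace_idt (Rf S T : finType) (K : op S -> op T) (X : op (Rf * S)%type) :
  trace_preserving K -> \tr (idt K X) = \tr X.
Proof.
move=> tpK; rewrite [LHS]trace_rent_pair [RHS]trace_rent_pair; apply: eq_bigr=> r _.
transitivity (\tr (K (slice X r r))).
  by rewrite trace_rent; apply: eq_bigr=> t _; rewrite rent_idt.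
by rewrite tpK trace_rent; apply: eq_bigr=> t _; rewrite rent_slice.
Qed.

Lemma density_maxent (T : finType) : (0 < #|T|)%N -> density (maxent R T).
Proof.
move=> T0; have nz : #|T|%:R != 0 :> C by rewrite pnatr_eq0 -lt0n.
split.
  (* The unnormalized maximally entangled vector, as a matrix with one column. *)
  pose v : 'M[C]_(#|{: T * T}|, #|{: unit}|) := rmk (fun u _ => (u.1 == u.2)%:R).
  have -> : maxent R T = #|T|%:R^-1 *: (v *m adj v).
    apply: rentP=> a b; rewrite rent_maxent rentZ rent_mul (big_pred1 tt); last by case.
    by rewrite rent_adj !rent_rmk rmorph_nat -natrM mulnb mulrC.
  by apply: psdmx_scale; [rewrite invr_ge0 ler0n|exact: psdmx_mul_adj].
rewrite trace_rent_pair (eq_bigr (fun=> #|T|%:R^-1)) => [|x _].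
  by rewrite sumr_const -[X in X = _]mulr_natl mulfV.
rewrite (eq_bigr (fun y => (x == y)%:R * #|T|%:R^-1)) ?sum_delta_l // => y _.
by rewrite rent_maxent /= andbb.
Qed.

(** The rule [ln (c y) = ln c + ln y] fails at [y = 0], where [ln 0 = 0]; the support condition
    gives such eigenvalues zero weight. *)
Lemma trace_ln_scale n (X Y : 'M[C]_n) (c : R) : 0 < c ->
  psdmx X -> psdmx Y -> suppmx X Y ->
  Re (\tr (X *m fcalc (@ln R) (c%:C%C *: Y))) =
  ln c * Re (\tr X) + Re (\tr (X *m fcalc (@ln R) Y)).
Proof.
move=> c0 pX pY s; have [hX hY] := (psdmx_hermitian pX, psdmx_hermitian pY).
rewrite (fcalc_scale _ _ hY) (trace_overlapl Y hX).
have main (G : (R -> R) -> R) :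
    (forall f, G f = \sum_i \sum_j overlap X Y i j * (eigv X i * f (eigv Y j))) ->
    G (fun x => ln (c * x)) =
      ln c * (\sum_i \sum_j overlap X Y i j * eigv X i) + G (@ln R).
  move=> e; rewrite !e mulr_sumr -big_split; apply: eq_bigr=> i _.
  rewrite mulr_sumr -big_split; apply: eq_bigr=> j _ /=; rewrite !(mulrA (overlap X Y i j)).
  have [->|nz] := eqVneq (overlap X Y i j * eigv X i) 0; first by rewrite !(mul0r, mulr0) addr0.
  have [_ y0] := eigv_supp pX pY s nz.
  by rewrite lnM ?posrE //; ring.
apply: (main (fun f => Re (\tr (X *m fcalc f Y)))) => f.
by rewrite -{1}(fcalc_id hX) -sum_overlap.
Qed.

Lemma suppmx_scale n (X Y : 'M[C]_n) (c : C) : c != 0 -> suppmx X (c *: Y) <-> suppmx X Y.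
Proof.
move=> c0; split=> h v.
  by move=> Yv; apply: h; rewrite -scalemxAl Yv scaler0.
rewrite -scalemxAl => /eqP; rewrite scaler_eq0 (negPf c0) => /eqP; exact: h.
Qed.

Lemma drel_tens1 (S T : finType) (X : op (S * T)%type) (Y : op T) (c : R) : 0 < c ->
  density X -> psd Y -> suppmx X (tens (1%:M : op S) Y) ->
  drel X (c%:C%C *: tens (1%:M : op S) Y) =
  - ln c - vNent X - Re (\tr (ptr1 X *m logm Y)).
Proof.
move=> c0 [pX tX] pY s; rewrite /drel mulmxBr [\tr _]raddfB ReB.
have := trace_ln_scale c0 pX (psd_tens1 (S := S) pY) s.
rewrite fcalc_tens1; last exact: psdmx_hermitian.
rewrite tX mulr1 trace_mul_tens1 => e.
apply: etrans (congr1 (fun z => Re (\tr (X *m fcalc (@ln R) X)) - z) e) _.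
by rewrite /vNent !logmE; move: (Re _) (Re _) => a b; ring.
Qed.

End Maps.

(** * Teleportation *)

Section Teleportation.
Variable R : realType.
Local Notation C := (R[i]).
Local Notation Re := (@complex.Re R).
Local Notation op := (op R).

(* The one-design condition tested on matrix units. *)
Definition design (G S : finType) (W : G -> op S) :=
  forall a b i j, \sum_g rent (W g) a i * (rent (W g) b j)^* =
    ((a == b) && (i == j))%:R * (#|G|%:R / #|S|%:R).

Lemma idt_maxentE (S T : finType) (K : op S -> op T) : is_linear_map K ->
  idt K (maxent R S) =
  #|S|%:R^-1 *: \sum_x \sum_y tens (eunit R x y) (K (eunit R x y)).
Proof.
move=> linK; apply: rentP=> -[r a] [r' b]; rewrite rent_idt /= slice_maxent (is_linearZ linK).
rewrite !rentZ rent_sum; congr (_ * _).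
rewrite (eq_bigr (fun x => (r == x)%:R * rent (K (eunit R x r')) a b)) ?sum_delta_l // => x _.
rewrite rent_sum (eq_bigr (fun y => (r == x)%:R * ((r' == y)%:R * rent (K (eunit R x y)) a b))).
  by rewrite -mulr_sumr sum_delta_l.
by move=> y _; rewrite rent_tens rent_eunit /= -mulnb natrM [x == r]eq_sym [y == r']eq_sym mulrA.
Qed.

Lemma rent_uconj_outer (S : finType) (U : op S) (f g : S -> C) a b :
  rent (uconj U (rmk (fun x y => f x * (g y)^*))) a b =
  (\sum_x rent U a x * f x) * (\sum_y rent U b y * g y)^*.
Proof.
rewrite rent_mul rmorph_sum mulr_sumr; apply: eq_bigr=> y _.
rewrite rent_mul rent_adj rmorphM /= [_^* * _]mulrC mulrA; congr (_ * _).
by rewrite mulr_suml; apply: eq_bigr=> x _; rewrite rent_rmk mulrA.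
Qed.

Lemma rent_uconj_eunit (S : finType) (L : op S) x y a b :
  rent (uconj L (eunit R x y)) a b = rent L a x * (rent L b y)^*.
Proof.
have -> : eunit R x y = rmk (fun s t => (x == s)%:R * ((y == t)%:R : C)^*).
  by apply: rentP=> s t; rewrite rent_eunit rent_rmk rmorph_nat -natrM mulnb.
by rewrite rent_uconj_outer !sum_delta_r.
Qed.

(** The transpose trick: acting with [L] on the reference of a Choi state amounts to feeding [K]
    with an outer product of rows of [L]. *)
Lemma rent_tens_conj_choi (S T : finType) (K : op S -> op T) (L : op S) (V : op T) u v :
  is_linear_map K ->
  rent (uconj (tens L V) (idt K (maxent R S))) u v = #|S|%:R^-1 *
  rent (uconj V (K (rmk (fun x y => rent L u.1 x * (rent L v.1 y)^*)))) u.2 v.2.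
Proof.
move=> linK; rewrite (idt_maxentE linK) (is_linearZ (uconj_linear _)) rentZ; congr (_ * _).
have lin := comp_linear (uconj_linear V) linK.
rewrite (is_linear_eunit _ lin) (is_linear_sum (uconj_linear _)) !rent_sum; apply: eq_bigr=> x _.
rewrite (is_linear_sum (uconj_linear _)) !rent_sum; apply: eq_bigr=> y _.
by rewrite uconj_tens rent_tens rent_uconj_eunit rentZ rent_rmk.
Qed.

Variables (S T G : finType) (W : G -> op S) (V : G -> op T) (B : op (S * S)%type).
Hypotheses (S0 : (0 < #|S|)%N) (G0 : (0 < #|G|)%N).
Hypotheses (unitW : forall g, unitary (W g)) (unitV : forall g, unitary (V g)).
Hypothesis designW : design W.

(** The column [k] of [B], reshaped into a square matrix, times the entrywise conjugate of [W g]. *)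
Let L g k : op S := rmk (fun r x => \sum_y rent B (r, y) k * (rent (W g) y x)^*).

(* The teleportation of [B *m adj B] through a Choi state: the Bell measurement has outcome
   [(g, k)], and [V g] is the correction. *)
Definition tele (gk : G * (S * S)) : op (S * T)%type :=
  sqrtC (#|S|%:R / #|G|%:R) *: tens (L gk.1 gk.2) (V gk.1).

Let card_ratio_ge0 : 0 <= (#|S|%:R / #|G|%:R : C).
Proof. by rewrite divr_ge0 ?ler0n. Qed.

Let sqrt_ratio : sqrtC (#|S|%:R / #|G|%:R) * (sqrtC (#|S|%:R / #|G|%:R))^* = #|S|%:R / #|G|%:R :> C.
Proof. by rewrite conj_Creal ?ger0_real ?sqrtC_ge0 // -expr2 sqrtCK. Qed.

(** Unitarity of [W g] cancels the conjugate built into [L g k], so the result no longer depends on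
    the outcome [g]. *)
Lemma uconj_tele_row g k r r' :
  uconj (W g) (rmk (fun x y => rent (L g k) r x * (rent (L g k) r' y)^*)) =
  rmk (fun z z' => rent B (r, z) k * (rent B (r', z') k)^*).
Proof.
have e q z : \sum_x rent (W g) z x * rent (L g k) q x = rent B (q, z) k.
  under eq_bigr do rewrite rent_rmk mulr_sumr.
  rewrite exchange_big (eq_bigr (fun y => (z == y)%:R * rent B (q, y) k)) ?sum_delta_l // => y _.
  rewrite -(unitary_ent z y (unitW g)) mulr_suml; apply: eq_bigr=> x _; ring.
by apply: rentP=> z z'; rewrite rent_uconj_outer rent_rmk !e.
Qed.

(** By covariance the correction [V g] acts as [W g] on the input of [K], so all outcomes [g]
    contribute equally, each with weight [1 / |G|]. The sum over [k] then rebuilds [B *m adj B] from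
    the columns of [B]. *)
Lemma kraus_tele (K : op S -> op T) : is_linear_map K ->
  (forall X g, K (uconj (W g) X) = uconj (V g) (K X)) ->
  kraus tele (idt K (maxent R S)) = idt K (B *m adj B).
Proof.
move=> linK cov; have nS : #|S|%:R != 0 :> C by rewrite pnatr_eq0 -lt0n.
have nG : #|G|%:R != 0 :> C by rewrite pnatr_eq0 -lt0n.
apply: rentP=> u v; rewrite rent_sum.
pose F k := rent (K (rmk (fun z z' => rent B (u.1, z) k * (rent B (v.1, z') k)^*))) u.2 v.2.
have e g k : rent (tele (g, k) *m idt K (maxent R S) *m adj (tele (g, k))) u v = #|G|%:R^-1 * F k.
  rewrite adjmxZ -scalemxAl -scalemxAr -scalemxAl scalerA rentZ.
  rewrite [_^* * _]mulrC sqrt_ratio -/(uconj (tens (L g k) (V g)) _) rent_tens_conj_choi //.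
  by rewrite -cov uconj_tele_row -/(F k) mulrA (mulrAC #|S|%:R) mulfV // mul1r.
rewrite (eq_bigr (fun gk : G * (S * S) => #|G|%:R^-1 * F gk.2)); last by case=> g k _; exact: e.
rewrite -(pair_bigA _ (fun g k => #|G|%:R^-1 * F k)) /= sumr_const -mulr_sumr.
rewrite -[X in X = _]mulr_natl mulrA mulfV // mul1r rent_idt.
have -> : slice (B *m adj B) u.1 v.1 =
    \sum_k rmk (fun z z' => rent B (u.1, z) k * (rent B (v.1, z') k)^*).
  apply: rentP=> s t; rewrite rent_slice rent_mul rent_sum; apply: eq_bigr=> k _.
  by rewrite rent_rmk rent_adj.
by rewrite (is_linear_sum linK) rent_sum.
Qed.

Lemma tele_preserves_trace : \tr (B *m adj B) = 1 ->
  \sum_gk adj (tele gk) *m tele gk = 1%:M.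
Proof.
move=> tB; have nS : #|S|%:R != 0 :> C by rewrite pnatr_eq0 -lt0n.
have nG : #|G|%:R != 0 :> C by rewrite pnatr_eq0 -lt0n.
have e g k : adj (tele (g, k)) *m tele (g, k) =
    (#|S|%:R / #|G|%:R) *: tens (adj (L g k) *m L g k) (1%:M : op T).
  rewrite adjmxZ -scalemxAl -scalemxAr scalerA [_^* * _]mulrC sqrt_ratio adj_tens mul_tens.
  by rewrite (unitaryC (unitV g)).
rewrite -(pair_bigA _ (fun g k => adj (tele (g, k)) *m tele (g, k))) /=.
(* The design condition averages [W g] away and leaves the identity times [tr (B B^dag) = 1]; the
   factor [|G| / |S|] is what the normalization of [tele] compensates. *)
have LL x y : \sum_g \sum_k rent (adj (L g k) *m L g k) x y = (x == y)%:R * (#|G|%:R / #|S|%:R).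
  have l g k : rent (adj (L g k) *m L g k) x y = \sum_r \sum_z \sum_z'
      ((rent B (r, z) k)^* * rent B (r, z') k) * (rent (W g) z x * (rent (W g) z' y)^*).
    rewrite rent_mul; apply: eq_bigr=> r _; rewrite rent_adj !rent_rmk rmorph_sum mulr_suml.
    apply: eq_bigr=> z _; rewrite mulr_sumr; apply: eq_bigr=> z' _.
    by rewrite rmorphM /= conjCK; ring.
  under eq_bigr do under eq_bigr do rewrite l.
  rewrite exchange_big /=.
  transitivity (\sum_k \sum_r \sum_z ((x == y)%:R * (#|G|%:R / #|S|%:R)) *
       (rent B (r, z) k * (rent B (r, z) k)^*)).
    apply: eq_bigr=> k _; rewrite exchange_big /=; apply: eq_bigr=> r _.
    rewrite exchange_big /=; apply: eq_bigr=> z _; rewrite exchange_big /=.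
    rewrite (eq_bigr (fun z' => (z == z')%:R * ((rent B (r, z) k)^* * rent B (r, z') k *
       ((x == y)%:R * (#|G|%:R / #|S|%:R))))); first by rewrite sum_delta_l; ring.
    by move=> z' _; rewrite -mulr_sumr designW -mulnb natrM; ring.
  under eq_bigr do under eq_bigr do rewrite -mulr_sumr.
  under eq_bigr do rewrite -mulr_sumr.
  rewrite -mulr_sumr -[RHS]mulr1 -tB trace_rent; congr (_ * _).
  rewrite [RHS](eq_bigr (fun u => \sum_k rent B u k * (rent B u k)^*)); last first.
    by move=> u _; rewrite rent_mul; apply: eq_bigr=> k _; rewrite rent_adj.
  rewrite [RHS]exchange_big /=; apply: eq_bigr=> k _.
  by rewrite pair_bigA; apply: eq_bigr=> -[].
apply: rentP=> -[x c] [y c']; rewrite rent_sum.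
rewrite (eq_bigr (fun g => (#|S|%:R / #|G|%:R) * ((c == c')%:R *
    (\sum_k rent (adj (L g k) *m L g k) x y)))); last first.
  move=> g _; rewrite rent_sum !mulr_sumr; apply: eq_bigr=> k _.
  by rewrite e rentZ rent_tens rent1 /=; ring.
rewrite -!mulr_sumr LL rent1 xpair_eqE -mulnb natrM; field.
by rewrite nS nG.
Qed.

End Teleportation.

(** * Covariant bipartite channels *)

Section Bipartite.
Variable R : realType.
Local Notation C := (R[i]).
Local Notation Re := (@complex.Re R).
Local Notation op := (op R).

Lemma is_linear_ext_eunit (S T : finType) (F G : op S -> op T) :
  is_linear_map F -> is_linear_map G ->
  (forall x y, F (eunit R x y) = G (eunit R x y)) -> forall X, F X = G X.
Proof.
move=> linF linG h X; rewrite (is_linear_eunit X linF) (is_linear_eunit X linG).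
by apply: eq_bigr=> x _; apply: eq_bigr=> y _; rewrite h.
Qed.

Lemma ptr1_tens (S T : finType) (X : op S) (Y : op T) : ptr1 (tens X Y) = \tr X *: Y.
Proof.
apply: rentP=> a b; rewrite rent_ptr1 rentZ trace_rent mulr_suml.
by apply: eq_bigr=> s _; rewrite rent_tens.
Qed.

Lemma eunit_tens (S T : finType) (x y : S * T) :
  eunit R x y = tens (eunit R x.1 y.1) (eunit R x.2 y.2).
Proof.
apply: rentP=> -[a b] [c d]; rewrite rent_tens !rent_eunit -natrM mulnb.
by case: x y => [x1 x2] [y1 y2]; rewrite !xpair_eqE /= andbACA.
Qed.

Lemma trace_uconj (S : finType) (U X : op S) : unitary U -> \tr (uconj U X) = \tr X.
Proof. by move=> u; rewrite /uconj mxtrace_mulC mulmxA unitaryC // mul1mx. Qed.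

Lemma uconj1 (S : finType) (X : op S) : uconj 1%:M X = X.
Proof. by rewrite /uconj adjmx1 mulmx1 mul1mx. Qed.

Lemma ptr1_uconj (S T : finType) (U : op S) (V : op T) (X : op (S * T)%type) : unitary U ->
  ptr1 (uconj (tens U V) X) = uconj V (ptr1 X).
Proof.
move=> u; move: X; apply: is_linear_ext_eunit.
- exact: comp_linear (@ptr1_linear _ _ _) (uconj_linear _).
- exact: comp_linear (uconj_linear _) (@ptr1_linear _ _ _).
move=> x y; rewrite eunit_tens uconj_tens !ptr1_tens trace_uconj //.
by rewrite (is_linearZ (uconj_linear V)).
Qed.

Lemma tensmap_replacerE (S1 S2 T1 T2 : finType) (M : op S2 -> op T2) (X : op (S1 * S2)%type) :
  is_linear_map M ->
  tensmap (@replacer R S1 T1) M X = tens (1%:M : op T1) (M (ptr1 X)).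
Proof.
move=> linM.
have lin : is_linear_map (fun X : op (S1 * S2)%type => tens (1%:M : op T1) (M (ptr1 X))).
  exact: comp_linear (@tens_linear _ _ _ _) (comp_linear linM (@ptr1_linear _ _ _)).
rewrite (is_linear_eunit X lin); apply: eq_bigr=> x _; apply: eq_bigr=> y _.
rewrite entE [in RHS]eunit_tens ptr1_tens (is_linearZ linM) (is_linearZ (@tens_linear _ _ _ _)).
congr (_ *: _); apply: rentP=> a b.
by rewrite rentZ !rent_tens /replacer rentZ mulrA.
Qed.

Lemma design_tens (G H P Q : finType) (U : G -> op P) (U' : H -> op Q) :
  design U -> design U' -> design (fun k : G * H => tens (U k.1) (U' k.2)).
Proof.
move=> dU dU' [a a'] [b b'] [i i'] [j j'].
rewrite -(pair_bigA _ (fun g h => rent (tens (U g) (U' h)) (a, a') (i, i') *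
    (rent (tens (U g) (U' h)) (b, b') (j, j'))^*)) /=.
transitivity ((\sum_g rent (U g) a i * (rent (U g) b j)^*) *
   (\sum_h rent (U' h) a' i' * (rent (U' h) b' j')^*)).
  rewrite mulr_suml; apply: eq_bigr=> g _; rewrite mulr_sumr; apply: eq_bigr=> h _.
  by rewrite !rent_tens rmorphM /=; ring.
rewrite dU dU' !xpair_eqE !card_prod !natrM invfM -!mulnb !natrM; ring.
Qed.

(** * Conditional entropy of a covariant channel from [P Q] to [A E] *)

Section Covariant.
(** [P] stands for A' and [Q] for B'C', while [E] is BC or, after discarding C, only B. At the index
    [h0] both unitaries of the second symmetry are the identity. *)
Variables (P Q A E G H : finType).
Variables (U : G -> op P) (U' : H -> op Q) (V : G -> op A) (V' : H -> op E) (h0 : H).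
Variable K : op (P * Q)%type -> op (A * E)%type.
Hypotheses (P0 : (0 < #|P|)%N) (Q0 : (0 < #|Q|)%N) (G0 : (0 < #|G|)%N).
Hypotheses (unitU : forall g, unitary (U g)) (unitU' : forall h, unitary (U' h)).
Hypotheses (unitV : forall g, unitary (V g)) (unitV' : forall h, unitary (V' h)).
Hypotheses (U'1 : U' h0 = 1%:M) (V'1 : V' h0 = 1%:M).
Hypotheses (designU : design U) (designU' : design U').
Hypothesis chK : channel K.
Hypothesis covK : forall X g h,
  K (uconj (tens (U g) (U' h)) X) = uconj (tens (V g) (V' h)) (K X).

Let linK : is_linear_map K. Proof. by case: chK. Qed.
Let nP : #|P|%:R != 0 :> C. Proof. by rewrite pnatr_eq0 -lt0n. Qed.
Let nG : #|G|%:R != 0 :> C. Proof. by rewrite pnatr_eq0 -lt0n. Qed.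

(** The one-design average over the first factor alone replaces it by the maximally mixed state. *)
Lemma twirl (X : op (P * Q)%type) :
  tens (#|P|%:R^-1 *: (1%:M : op P)) (ptr1 X) =
  #|G|%:R^-1 *: \sum_g uconj (tens (U g) (1%:M : op Q)) X.
Proof.
move: X; apply: is_linear_ext_eunit.
- exact: comp_linear (@tens_linear _ _ _ _) (@ptr1_linear _ _ _).
- move=> a X Y; rewrite scalerA mulrC -scalerA -scalerDr; congr (_ *: _).
  by rewrite scaler_sumr -big_split; apply: eq_bigr=> g _; exact: uconj_linear.
move=> [i i'] [j j']; rewrite eunit_tens ptr1_tens trace_eunit.
apply: rentP=> -[a a'] [b b']; rewrite rent_tens !rentZ rent1 rent_sum /=.
rewrite (eq_bigr (fun g => (rent (U g) a i * (rent (U g) b j)^*) * rent (eunit R i' j') a' b')).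
  by rewrite -mulr_suml designU -mulnb natrM; field; rewrite nP nG.
by move=> g _; rewrite uconj_tens uconj1 rent_tens rent_uconj_eunit.
Qed.

Definition marginal_map (Y : op Q) : op E :=
  ptr1 (K (tens (#|P|%:R^-1 *: (1%:M : op P)) Y)).

(** After twirling, covariance at [h0] turns each [U g] into [V g] on the output [A], which the
    partial trace over [A] does not see. *)
Lemma marginal_map_ptr1 X : marginal_map (ptr1 X) = ptr1 (K X).
Proof.
rewrite /marginal_map twirl (is_linearZ linK) (is_linear_sum linK).
rewrite (is_linearZ (@ptr1_linear _ _ _)) (is_linear_sum (@ptr1_linear _ _ _)).
rewrite (eq_bigr (fun=> ptr1 (K X))) => [|g _].
  by rewrite sumr_const -[X in _ *: X]scaler_nat scalerA mulVf // scale1r.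
by rewrite -U'1 covK V'1 ptr1_uconj // uconj1.
Qed.

Lemma marginal_map_channel : channel marginal_map.
Proof.
have [_ cpK tpK] := chK; split.
- exact: comp_linear (@ptr1_linear _ _ _) (comp_linear linK (@tens_linear _ _ _ _)).
- move=> n X pX.
  (* The maximally mixed state of [P] is inserted between the reference and [Q], so that [K]
     applies; tracing out [A] afterwards gives the output of [marginal_map]. *)
  pose X' : op ('I_n * (P * Q))%type := #|P|%:R^-1 *:
    relabel (fun u : ('I_n * (P * Q))%type => (u.2.1, (u.1, u.2.2))) (tens (1%:M : op P) X).
  have pX' : psd X'.
    apply: psdmx_scale; first by rewrite invr_ge0 ler0n.
    exact/psd_relabel/psd_tens1.
  have -> : idt marginal_map X =
      ptr1 (relabel (fun u : (A * ('I_n * E))%type => (u.2.1, (u.1, u.2.2))) (idt K X')).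
    apply: rentP=> u v; rewrite rent_idt !rent_ptr1; apply: eq_bigr=> a _.
    rewrite rent_relabel rent_idt /=; congr (rent (K _) _ _).
    apply: rentP=> s t; rewrite rent_tens !rent_slice !rentZ rent_relabel rent_tens /=.
    by rewrite mulrA.
  exact/psd_ptr1/psd_relabel/cpK.
move=> X; rewrite trace_ptr1 tpK trace_tens mxtraceZ mxtrace1.
by rewrite mulVf // mul1r.
Qed.

Let ref := @tensmap R P Q A E (@replacer R P A) marginal_map.

Let refE X : ref X = tens (1%:M : op A) (ptr1 (K X)).
Proof.
rewrite /ref tensmap_replacerE ?marginal_map_ptr1 //.
by case: marginal_map_channel.
Qed.

Let ref_linear : is_linear_map ref.
Proof.
move=> a X Y; rewrite !refE linK (@ptr1_linear _ _ _) (@tens_linear _ _ _ _) //.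
Qed.

Let ref_cov X g h : ref (uconj (tens (U g) (U' h)) X) = uconj (tens (V g) (V' h)) (ref X).
Proof.
rewrite !refE covK ptr1_uconj // uconj_tens; congr tens.
by rewrite /uconj mulmx1 unitV.
Qed.

(** Regroups the reference and output systems so that [P A] is the first factor, on which the
    reference operator is proportional to the identity. *)
Let assoc (u : (P * A) * (Q * E)) : (P * Q) * (A * E) :=
  ((u.1.1, u.2.1), (u.1.2, u.2.2)).

Let assoc_bij : bijective assoc.
Proof.
exists (fun u => ((u.1.1, u.2.1), (u.1.2, u.2.2))); first by case=> [[? ?] [? ?]].
by case=> [[? ?] [? ?]].
Qed.

Let choi : op ((P * Q) * (A * E))%type := idt K (maxent R (P * Q)%type).
Let rho : op ((P * A) * (Q * E))%type := relabel assoc choi.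

Let PQ0 : (0 < #|{: P * Q}|)%N. Proof. by rewrite card_prod muln_gt0 P0. Qed.

Let density_choi : density choi.
Proof.
have [p t] := @density_maxent R _ PQ0; have [_ cpK tpK] := chK.
by split; [exact: psd_idt|rewrite trace_idt].
Qed.

Let density_rho : density rho.
Proof.
have [p t] := density_choi.
by split; [exact: psd_relabel|rewrite (trace_relabel assoc_bij)].
Qed.

(** The maximally entangled input has the maximally mixed marginal [1 / |P|] on its reference [P].
    This constant is the source of the term [ln |P|]. *)
Lemma relabel_choi_replacer (M : op Q -> op E) : is_linear_map M ->
  relabel assoc (idt (tensmap (@replacer R P A) M) (maxent R (P * Q)%type)) =
  (#|P|%:R^-1 : R)%:C%C *: tens (1%:M : op (P * A)%type) (idt M (maxent R Q)).
Proof.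
move=> linM; apply: rentP=> -[[p a] [q b]] [[p' a'] [q' b']].
rewrite rent_relabel rent_idt /= tensmap_replacerE // rentZ !rent_tens rent_idt /= !slice_maxent.
rewrite (is_linearZ (@ptr1_linear _ _ _)) eunit_tens ptr1_tens trace_eunit /=.
rewrite !(is_linearZ linM) !rentZ !rent1 xpair_eqE -mulnb natrM card_prod natrM invfM.
rewrite fmorphV rmorph_nat; ring.
Qed.

(** For [marginal_map] the second argument in Klein's inequality thus equals the first, which makes
    the bound tight. *)
Lemma ptr1_rho : ptr1 rho = idt marginal_map (maxent R Q).
Proof.
have [linM _ _] := marginal_map_channel.
apply: rentP=> -[q b] [q' b'].
rewrite rent_idt rent_ptr1 /= slice_maxent (is_linearZ linM) rentZ.
transitivity (\sum_p \sum_a rent rho ((p, a), (q, b)) ((p, a), (q', b'))).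
  by rewrite pair_bigA; apply: eq_bigr=> -[].
rewrite (eq_bigr (fun p => (#|P|%:R^-1 * #|Q|%:R^-1) *
   rent (marginal_map (eunit R q q')) b b')).
  by rewrite sumr_const -[X in X = _]mulr_natl !mulrA mulfV // mul1r.
move=> p _.
have -> : eunit R q q' = ptr1 (eunit R (p, q) (p, q')).
  by rewrite eunit_tens ptr1_tens trace_eunit eqxx scale1r.
rewrite marginal_map_ptr1 rent_ptr1 mulr_sumr; apply: eq_bigr=> a _.
rewrite rent_relabel rent_idt /= slice_maxent (is_linearZ linK) rentZ.
by rewrite card_prod natrM invfM.
Qed.

Let lnPE : - ln (#|P|%:R^-1 : R) = ln #|P|%:R.
Proof. by rewrite lnV ?opprK // posrE ltr0n. Qed.

Let drel_choi (M : op Q -> op E) : channel M ->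
  suppmx rho (tens (1%:M : op (P * A)%type) (idt M (maxent R Q))) ->
  drel choi (idt (tensmap (@replacer R P A) M) (maxent R (P * Q)%type)) =
  ln #|P|%:R - vNent rho - Re (\tr (ptr1 rho *m logm (idt M (maxent R Q)))).
Proof.
move=> [linM cpM tpM] s.
have pM : psd (idt M (maxent R Q)) by apply: psd_idt => //; have [] := @density_maxent R _ Q0.
have p0 : 0 < (#|P|%:R^-1 : R) by rewrite invr_gt0 ltr0n.
have hC : adj choi = choi by have [/psdmx_hermitian] := density_choi.
set sg := idt _ _.
(* The explicit form of [sg] is known only after regrouping, so Hermiticity is proved there and
   carried back. *)
have hS : adj sg = sg.
  have e : relabel assoc (adj sg) = relabel assoc sg.
    rewrite relabel_adj relabel_choi_replacer // psdmx_hermitian //.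
    by apply: psdmx_scale; [rewrite ler0c ltW|exact: psd_tens1].
  apply: rentP=> x y; have [f _ fK] := assoc_bij.
  have := congr1 (fun M => rent M (f x) (f y)) e.
  by rewrite !rent_relabel !fK.
rewrite -(drel_relabel assoc_bij hC hS) relabel_choi_replacer // -/rho.
by rewrite drel_tens1 // lnPE.
Qed.

Let supp_choi (M : op Q -> op E) : channel M ->
  suppmx choi (idt (tensmap (@replacer R P A) M) (maxent R (P * Q)%type)) <->
  suppmx rho (tens (1%:M : op (P * A)%type) (idt M (maxent R Q))).
Proof.
move=> [linM cpM tpM].
apply: iff_trans (iff_sym (suppmx_relabel assoc_bij _ _)) _.
by rewrite relabel_choi_replacer //; apply: suppmx_scale; rewrite fmorph_eq0 invr_eq0 pnatr_eq0 -lt0n.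
Qed.

Let relentE (T : finType) (X Y : op T) : suppmx X Y -> relent X Y = (drel X Y)%:E.
Proof. by move=> s; rewrite /relent asboolT // !logmE. Qed.

(** The maximally entangled input is tested, and Klein's inequality compares the marginal of [rho]
    with the Choi state of [M]. *)
Lemma chdiv_replacer_ge (M : op Q -> op E) : channel M ->
  ((ln #|P|%:R - condent rho)%:E <= chdiv K (tensmap (@replacer R P A) M))%E.
Proof.
move=> chM.
apply: (@le_trans _ _ (relent choi (idt (tensmap (@replacer R P A) M) (maxent R (P * Q)%type)))).
  (* Without the support inclusion the divergence is infinite and the bound is trivial. *)
  have [s|ns] := pselect (suppmx choi (idt (tensmap (@replacer R P A) M) (maxent R (P * Q)%type)));
    last by rewrite /relent asboolF // leey.
  rewrite relentE //; have s' := (supp_choi chM).1 s.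
  rewrite (drel_choi chM s') lee_fin /condent.
  have [linM cpM tpM] := chM; have [pm tm] := @density_maxent R _ Q0.
  have [pr tr] := density_rho.
  have := klein (psd_ptr1 pr) (psd_idt cpM pm) (suppmx_tens1 s').
  rewrite trace_ptr1 tr trace_idt // tm => /(_ erefl).
  rewrite /drel mulmxBr [\tr _]raddfB ReB -!logmE subr_ge0 => k.
  by rewrite opprB addrA addrAC lerD2l lerNr /vNent opprK.
apply: ereal_sup_ubound; exists (maxent R (P * Q)%type) => //.
exact: density_maxent.
Qed.

(** Every input is teleported through the Choi states of [K] and of [ref], so by monotonicity its
    divergence is at most that of the Choi states, which [ptr1_rho] evaluates. *)
Lemma chdiv_replacer_le :
  (chdiv K ref <= (ln #|P|%:R - condent rho)%:E)%E.
Proof.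
apply: ge_ereal_sup => _ [X [pX tX] <-].
have [pC tC] := density_choi; have [pr tr] := density_rho.
have chM := marginal_map_channel; have [linM cpM tpM] := chM.
have s' : suppmx rho (tens (1%:M : op (P * A)%type) (idt marginal_map (maxent R Q))).
  by rewrite -ptr1_rho; exact: suppmx_ptr1.
have s := (supp_choi chM).2 s'; rewrite -/ref in s.
have pS : psd (idt ref (maxent R (P * Q)%type)).
  have [pm _] := @density_maxent R _ Q0.
  have [f fK Kf] := assoc_bij.
  have -> : idt ref (maxent R (P * Q)%type) = relabel f (relabel assoc (idt ref (maxent R (P * Q)%type))).
    by apply: rentP=> x y; rewrite !rent_relabel !Kf.
  apply: psd_relabel; rewrite relabel_choi_replacer //.
  apply: psdmx_scale; first by rewrite ler0c invr_ge0 ler0n.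
  exact/psd_tens1/psd_idt.
have [B XE] := psdmx_factor pX; rewrite XE in tX *.
(* One Kraus family serves both maps: it depends on the input and the unitaries but not on the
   teleported channel. *)
pose T := tele (fun k : G * H => tens (U k.1) (U' k.2)) (fun k => tens (V k.1) (V' k.2)) B.
have GH0 : (0 < #|{: G * H}|)%N by rewrite card_prod muln_gt0 G0; apply/card_gt0P; exists h0.
have uU k : unitary (tens (U k.1) (U' k.2)) by exact: unitary_tens.
have uV k : unitary (tens (V k.1) (V' k.2)) by exact: unitary_tens.
have T1 : \sum_k adj (T k) *m T k = 1%:M.
  by apply: tele_preserves_trace => //; exact: design_tens.
have TK : kraus T choi = idt K (B *m adj B).
  by apply: kraus_tele => // Y k; exact: covK.
have TR : kraus T (idt ref (maxent R (P * Q)%type)) = idt ref (B *m adj B).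
  by apply: kraus_tele => // Y k; exact: ref_cov.
rewrite -TK -TR relentE; last exact: suppmx_kraus.
rewrite lee_fin; apply: le_trans (drel_kraus T1 pC pS s) _.
rewrite (drel_choi chM s') -ptr1_rho /condent /vNent.
by move: (Re _) (Re _) (ln _) => a b c; lra.
Qed.

Theorem inf_chdiv_replacer :
  ereal_inf [set chdiv K (tensmap (@replacer R P A) M) |
             M in [set M : op Q -> op E | channel M]] =
  (ln #|P|%:R - condent (relabel
    (fun u : ((P * A) * (Q * E))%type => ((u.1.1, u.2.1), (u.1.2, u.2.2)))
    (idt K (maxent R (P * Q)%type))))%:E.
Proof.
apply/eqP; rewrite eq_le; apply/andP; split.
  apply: le_trans chdiv_replacer_le; apply: ereal_inf_lbound.
  by exists marginal_map => //; exact: marginal_map_channel.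
by apply: le_ereal_inf_tmp => _ [M chM <-]; exact: chdiv_replacer_ge.
Qed.

End Covariant.
End Bipartite.

(** * Conditional mutual information *)

Section Tripartite.
Variable R : realType.
Local Notation op := (op R).

(** Evaluates the twirl on the matrix unit [eunit R i j] and clears the factor [1 / |G|]. *)
Lemma one_design_design (gT : finGroupType) (T : finType) (U : gT -> op T) :
  one_design U -> design U.
Proof.
move=> dU a b i j; have nG : #|gT|%:R != 0 :> R[i].
  by rewrite pnatr_eq0 -lt0n; apply/card_gt0P; exists 1%g.
have := congr1 (fun M => rent M a b) (dU (eunit R i j)).
rewrite !rentZ rent1 rent_sum trace_eunit.
under eq_bigr do rewrite -/(uconj _ _) rent_uconj_eunit.
move=> /(congr1 (fun z => #|gT|%:R * z)); rewrite mulrA mulfV // mul1r => ->.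
by rewrite -mulnb natrM; ring.
Qed.

Lemma condent_relabel (X Y Y' : finType) (f : Y' -> Y) (rho : op (X * Y)%type) :
  bijective f -> psd rho ->
  condent (relabel (fun u : (X * Y')%type => (u.1, f u.2)) rho) = condent rho.
Proof.
move=> bf pr; have bf2 : bijective (fun u : (X * Y')%type => (u.1, f u.2)).
  have [g fg gf] := bf; exists (fun u : (X * Y)%type => (u.1, g u.2)).
    by case=> a b /=; rewrite fg.
  by case=> a b /=; rewrite gf.
rewrite /condent (vNent_relabel bf2); last exact: psdmx_hermitian.
congr (_ - _); rewrite -[RHS](vNent_relabel bf); last exact/psdmx_hermitian/psd_ptr1.
congr vNent; apply: rentP=> s t; rewrite rent_relabel !rent_ptr1.
by apply: eq_bigr=> x _; rewrite rent_relabel.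
Qed.

Lemma tensA_relabel (A B D : finType) (X : op A) (Y : op B) (Z : op D) :
  relabel (fun u : ((A * B) * D)%type => (u.1.1, (u.1.2, u.2))) (tens X (tens Y Z)) =
  tens (tens X Y) Z.
Proof. by apply: rentP=> a b; rewrite rent_relabel !rent_tens /= mulrA. Qed.

Lemma ptr2E (S T : finType) (X : op (S * T)%type) :
  ptr2 X = ptr1 (relabel (fun u : (T * S)%type => (u.2, u.1)) X).
Proof.
by apply: rentP=> a b; rewrite rent_ptr1 rent_ptr2; apply: eq_bigr=> t _; rewrite rent_relabel.
Qed.

Lemma ptr2_uconj (S T : finType) (U : op S) (V : op T) (X : op (S * T)%type) : unitary V ->
  ptr2 (uconj (tens U V) X) = uconj U (ptr2 X).
Proof.
move=> uV; have bs : bijective (fun u : (T * S)%type => (u.2, u.1)).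
  by exists (fun u : (S * T)%type => (u.2, u.1)); case.
rewrite !ptr2E /uconj !(relabelM bs) relabel_adj.
have -> : relabel (fun u : (T * S)%type => (u.2, u.1)) (tens U V) = tens V U.
  by apply: rentP=> a b; rewrite rent_relabel !rent_tens mulrC.
by rewrite -/(uconj (tens V U) _) ptr1_uconj.
Qed.

Lemma trC_linear (A B D : finType) : is_linear_map (@trC R A B D).
Proof. exact: comp_linear (@ptr2_linear _ _ _) (@relabel_linear _ _ _ _). Qed.

Lemma rent_trC (A B D : finType) (X : op (A * (B * D))%type) u v :
  rent (trC X) u v = \sum_d rent X (u.1, (u.2, d)) (v.1, (v.2, d)).
Proof. by rewrite rent_ptr2; apply: eq_bigr=> d _; rewrite rent_relabel. Qed.

Lemma trC_uconj (A B D : finType) (X : op A) (Y : op B) (Z : op D) W : unitary Z ->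
  trC (uconj (tens X (tens Y Z)) W) = uconj (tens X Y) (trC W).
Proof.
move=> uZ; have ba : bijective (fun u : ((A * B) * D)%type => (u.1.1, (u.1.2, u.2))).
  exists (fun u : (A * (B * D))%type => ((u.1, u.2.1), u.2.2)); first by case=> [[? ?] ?].
  by case=> [? [? ?]].
by rewrite /trC /uconj !(relabelM ba) relabel_adj tensA_relabel -/(uconj (tens _ _) _) ptr2_uconj.
Qed.

Lemma channel_trC (S A B D : finType) (N : op S -> op (A * (B * D))%type) :
  channel N -> channel (fun X => trC (N X)).
Proof.
move=> [linN cpN tpN]; split.
- exact: comp_linear (@trC_linear _ _ _) linN.
- move=> n X pX.
  have -> : idt (fun X => trC (N X)) X =
      ptr1 (relabel (fun u : (D * ('I_n * (A * B)))%type =>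
        (u.2.1, (u.2.2.1, (u.2.2.2, u.1)))) (idt N X)).
    apply: rentP=> u v; rewrite rent_idt rent_trC rent_ptr1; apply: eq_bigr=> d _.
    by rewrite rent_relabel rent_idt.
  exact/psd_ptr1/psd_relabel/cpN.
move=> X; rewrite trace_ptr2 -tpN; apply: trace_relabel.
exists (fun u : (A * (B * D))%type => ((u.1, u.2.1), u.2.2)); first by case=> [[? ?] ?].
by case=> [? [? ?]].
Qed.

End Tripartite.

Theorem mainTheorem14 (R : realType) (A' B' C' A B C : finType)
  (N : op R (A' * (B' * C'))%type -> op R (A * (B * C))%type) :
  (0 < #|A'|)%N -> (0 < #|B'|)%N -> (0 < #|C'|)%N ->
  (0 < #|A|)%N -> (0 < #|B|)%N -> (0 < #|C|)%N ->
  channel N ->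
  tele_covariant N ->
  chcmi N =
  (cmi (relabel
          (fun u : (((A' * A) * ((B' * B) * C')) * C)%type =>
             ((u.1.1.1, (u.1.2.1.1, u.1.2.2)), (u.1.1.2, (u.1.2.1.2, u.2))))
          (choi_state N)))%:E.
Proof.
move=> A0 B0 C0 _ _ _ chN [gG [gH [gL [UA [UB [UC [V [W [Y]]]]]]]]].
move=> [[rUA rUB rUC] [dA dB dC] [rV rW rY] cov].
have [UA1 _ uUA] := rUA; have [UB1 _ uUB] := rUB; have [UC1 _ uUC] := rUC.
have [V1 _ uV] := rV; have [W1 _ uW] := rW; have [Y1 _ uY] := rY.
have [linN cpN tpN] := chN.
(* Covariance is given on densities, whereas twirling and teleportation apply it to arbitrary
   operators. *)
have covN X g h l : N (uconj (tens (UA g) (tens (UB h) (UC l))) X)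
    = uconj (tens (V g) (tens (W h) (Y l))) (N X).
  move: X; apply: is_linear_ext.
  - exact: comp_linear linN (uconj_linear _).
  - exact: comp_linear (uconj_linear _) linN.
  by move=> X dX; exact: cov.
have Q0 : (0 < #|{: B' * C'}|)%N by rewrite card_prod muln_gt0 B0.
have S0 : (0 < #|{: A' * (B' * C')}|)%N by rewrite card_prod muln_gt0 A0.
have G0 : (0 < #|gG|)%N by apply/card_gt0P; exists 1%g.
pose U' (k : gH * gL) := tens (UB k.1) (UC k.2).
have uU' k : unitary (U' k) by exact: unitary_tens.
have U'1 : U' (1%g, 1%g) = 1%:M by rewrite /U' UB1 UC1 tens11.
have dU : design UA by exact: one_design_design.
have dU' : design U' by apply: design_tens; exact: one_design_design.
(* The pair [(h, l)] is a single symmetry of B'C', acting on the output BC by [W h (x) Y l]. *)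
have eABC : chcondent_ABC N = _ := congr1 oppe (@inf_chdiv_replacer R A' (B' * C')%type A (B * C)%type
  gG (gH * gL)%type UA U' V (fun k => tens (W k.1) (Y k.2)) (1%g, 1%g) N A0 Q0 G0 uUA uU' uV
  (fun k => unitary_tens (uW k.1) (uY k.2)) U'1
  (etrans (congr2 (@tens R B C) W1 Y1) (tens11 R B C)) dU dU' chN
  (fun X g h => covN X g h.1 h.2)).
(* After tracing out C the unitary [Y l] disappears, and the pair [(h, l)] acts on B by [W h]
   alone. *)
have eAB : chcondent_AB N = _ := congr1 oppe (@inf_chdiv_replacer R A' (B' * C')%type A B
  gG (gH * gL)%type UA U' V (fun k => W k.1) (1%g, 1%g) (fun X => trC (N X)) A0 Q0 G0 uUA uU' uV
  (fun k => uW k.1) U'1 W1 dU dU' (channel_trC chN)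
  (fun X g h => etrans (congr1 (@trC R A B C) (covN X g h.1 h.2)) (trC_uconj (V g) (W h.1) (N X) (uY h.2)))).
have [pm _] := @density_maxent R _ S0.
have pC : psd (choi_state N) by exact: psd_idt.
have pC2 : psd (idt (fun X => trC (N X)) (maxent R (A' * (B' * C'))%type)).
  by apply: psd_idt => //; case: (channel_trC chN).
rewrite /chcmi eAB eABC -EFinN -EFinB; congr (_%:E).
rewrite /cmi; set r := (X in ptr2 X).
(* The statement orders the conditioning systems as R_B B R_C, the bipartite result as R_B R_C B;
   [f1] and [f2] reorder them without and with C. *)
pose f1 (u : ((B' * B) * C')%type) : ((B' * C') * B)%type := ((u.1.1, u.2), u.1.2).
have bf1 : bijective f1.
  by exists (fun u : ((B' * C') * B)%type => ((u.1.1, u.2), u.1.2)); case=> [[? ?] ?].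
pose f2 (u : (((B' * B) * C') * C)%type) : ((B' * C') * (B * C))%type :=
  ((u.1.1.1, u.1.2), (u.1.1.2, u.2)).
have bf2 : bijective f2.
  exists (fun u : ((B' * C') * (B * C))%type => (((u.1.1, u.2.1), u.1.2), u.2.2)).
    by case=> [[[? ?] ?] ?].
  by case=> [[? ?] [? ?]].
have -> : relabel (fun u : ((A' * A) * (((B' * B) * C') * C))%type => ((u.1, u.2.1), u.2.2)) r =
  relabel (fun u : ((A' * A) * (((B' * B) * C') * C))%type => (u.1, f2 u.2))
    (relabel (fun u : ((A' * A) * ((B' * C') * (B * C)))%type =>
       ((u.1.1, u.2.1), (u.1.2, u.2.2))) (choi_state N)).
  by rewrite /r !relabel_comp.
(* Discarding C from the Choi state of [N] gives the Choi state of [tr_C o N]. *)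
have -> : ptr2 r = relabel (fun u : ((A' * A) * ((B' * B) * C'))%type => (u.1, f1 u.2))
    (relabel (fun u : ((A' * A) * ((B' * C') * B))%type =>
       ((u.1.1, u.2.1), (u.1.2, u.2.2))) (idt (fun X => trC (N X)) (maxent R (A' * (B' * C'))%type))).
  apply: rentP=> u v; rewrite rent_ptr2 relabel_comp rent_relabel rent_idt rent_trC.
  by apply: eq_bigr=> c _; rewrite rent_relabel rent_idt.
rewrite (condent_relabel bf1); last exact: psd_relabel.
rewrite (condent_relabel bf2); last exact: psd_relabel.
by rewrite opprK opprB addrA subrK.
Qed.
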